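(* Assume there exist points $x_I<x_S$ and two continuous non-decreasing functions $Q_I,Q_S:\mathbb R\to\mathbb R$ with $Q_I(x)=0$ for $x\ge x_I$ and $Q_S(x)=0$ for $x\le x_S$, such that $$\mathbb E_xQ_I(I)+\mathbb E_xQ_S(S)=\begin{cases}G_1(x),& x\ge x_S,\\ G_2(x),& x\le x_I.\end{cases}$$ Define $V(x)=\mathbb E_xQ_I(I)+\mathbb E_xQ_S(S)$ for all $x\in\mathbb R$. If $G_1(x)\le V(x)\le G_2(x)$ for all $x\in[x_I,x_S]$, then for every $x$, $$V(x)=\inf_{\sigma}\sup_{\tau}M_x(\sigma,\tau)=\sup_{\tau}\inf_{\sigma}M_x(\sigma,\tau)=M_x(\sigma^*,\tau^* ),$$ where $\sigma^*=\inf\{t\ge0: X_t\le x_I\}$ and $\tau^*=\inf\{t\ge0:X_t\ge x_S\}$.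
   Context: Let $X=(X_t)_{t\ge0}$ be a Lévy process on a filtered probability space $(\Omega,\mathcal F,(\mathcal F_t)_{t\ge0},\mathbb P_x)$ satisfying the usual conditions, with $X_0=x$ under $\mathbb P_x$; $\mathbb E_x$ is the corresponding expectation. Stopping times are random variables $\tau:\Omega\to[0,\infty]$ (the value $\infty$ is allowed) with $\{\tau\le t\}\in\mathcal F_t$ for all $t$; infima and suprema over $\sigma,\tau$ range over all such stopping times. Fix $r>0$ and continuous functions $G_1\le G_2$ on $\mathbb R$ such that for $i=1,2$ and all $x$: $\mathbb E_x\big(\sup_{t\ge0}|e^{-rt}G_i(X_t)|\big)<\infty$ and $\lim_{t\to\infty}e^{-rt}G_i(X_t)=0$ a.s.; by convention $e^{-r\tau}G_i(X_\tau)=0$ on $\{\tau=\infty\}$. For stopping times $\sigma,\tau$ define $$M_x(\sigma,\tau)=\mathbb E_x\Big(e^{-r\tau}G_1(X_\tau)\mathbf 1_{\{\tau\le\sigma\}}+e^{-r\sigma}G_2(X_\sigma)\mathbf 1_{\{\sigma<\tau\}}\Big).$$ Let $e_r$ be an exponential random variable with parameter $r$, independent of $X$, and define $I=\inf\{X_t:0\le t\le e_r\}$, $S=\sup\{X_t:0\le t\le e_r\}$ (so under $\mathbb P_x$ these are the infimum and supremum of the process started at $x$). All expectations $\mathbb E_xQ_I(I)$, $\mathbb E_xQ_S(S)$ are assumed finite. *)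

(* Defs.v *)
From HB Require Import structures.
From mathcomp Require Import all_boot all_order all_algebra.
From mathcomp Require Import all_classical all_reals all_analysis.
Set Implicit Arguments. Unset Strict Implicit. Unset Printing Implicit Defensive.
Import Order.TTheory GRing.Theory Num.Theory.
Import numFieldNormedType.Exports.
Local Open Scope classical_set_scope.
Local Open Scope ring_scope.

Section Defs.
Context {d : measure_display} {Omega : measurableType d} {R : realType}.
Variable P : probability Omega R.

Definition filtration (F : R -> set (set Omega)) : Prop :=
  (forall t, 0 <= t -> sigma_algebra setT (F t)) /\
  (forall t A, 0 <= t -> F t A -> measurable A) /\
  (forall s t A, 0 <= s <= t -> F s A -> F t A).

Definition usual_conditions (F : R -> set (set Omega)) : Prop :=
  filtration F /\
  (forall t A, 0 <= t -> (forall s, t < s -> F s A) -> F t A) /\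
  (forall N, P.-negligible N -> F 0 N).

Definition levy_process (F : R -> set (set Omega)) (L : R -> Omega -> R) : Prop :=
  (forall w, L 0 w = 0) /\
  (forall t (B : set R), 0 <= t -> measurable B -> F t (L t @^-1` B)) /\
  (forall w t, 0 <= t -> (L s w) @[s --> t^'+] --> L t w) /\
  (forall w t, 0 < t -> exists l : R, (L s w) @[s --> t^'-] --> l) /\
  (forall s t A (B : set R), 0 <= s <= t -> F s A -> measurable B ->
     P (A `&` [set w | B (L t w - L s w)%R]) =
     (P A * P [set w | B (L t w - L s w)%R])%E) /\
  (forall s t (B : set R), 0 <= s <= t -> measurable B ->
     P [set w | B (L t w - L s w)] = P [set w | B (L (t - s) w)]).

Definition exponential_rv (r : R) (e : Omega -> R) : Prop :=
  measurable_fun setT e /\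
  (forall t, 0 <= t -> P [set w | t < e w] = (expR (- (r * t)))%:E).

Definition indep_of_process (e : Omega -> R) (L : R -> Omega -> R) : Prop :=
  forall (n : nat) (ts : 'I_n -> R) (Bs : 'I_n -> set R) (C : set R),
    (forall i, 0 <= ts i) -> (forall i, measurable (Bs i)) -> measurable C ->
    P ((\bigcap_i [set w | Bs i (L (ts i) w)]) `&` (e @^-1` C)) =
    (P (\bigcap_i [set w | Bs i (L (ts i) w)]) * P (e @^-1` C))%E.

Definition stopping_time (F : R -> set (set Omega)) (tau : Omega -> \bar R) : Prop :=
  (forall w, (0 <= tau w)%E) /\
  (forall t, 0 <= t -> F t [set w | (tau w <= t%:E)%E]).

(* e^{-rt} G(X_t) with X_t = x + L_t, and 0 at t = +oo *)
Definition disc (r : R) (G : R -> R) (L : R -> Omega -> R) (x : R)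
  (t : \bar R) (w : Omega) : R :=
  match t with
  | EFin t' => expR (- (r * t')) * G (x + L t' w)
  | _ => 0
  end.

Definition Mx (r : R) (G1 G2 : R -> R) (L : R -> Omega -> R) (x : R)
  (sigma tau : Omega -> \bar R) : \bar R :=
  \int[P]_w (if (tau w <= sigma w)%E then disc r G1 L x (tau w) w
             else disc r G2 L x (sigma w) w)%:E.

Definition Inf_e (L : R -> Omega -> R) (e : Omega -> R) (x : R) (w : Omega) : R :=
  inf [set x + L t w | t in [set t | 0 <= t <= e w]].
Definition Sup_e (L : R -> Omega -> R) (e : Omega -> R) (x : R) (w : Omega) : R :=
  sup [set x + L t w | t in [set t | 0 <= t <= e w]].

Definition hit_below (L : R -> Omega -> R) (x a : R) (w : Omega) : \bar R :=
  ereal_inf [set t%:E | t in [set t | 0 <= t /\ x + L t w <= a]].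
Definition hit_above (L : R -> Omega -> R) (x a : R) (w : Omega) : \bar R :=
  ereal_inf [set t%:E | t in [set t | 0 <= t /\ a <= x + L t w]].

End Defs.

(* Main.v *)
(* Write V = U - D with U(x) = E_x Q_S(S) and D(x) = - E_x Q_I(I), both nonnegative, and
   let sigma_I, tau_S be the two hitting times. By the memoryless property,
   E_x[e^{-r tau} U(X_tau)] is the expectation of Q_S of the supremum of X over
   [tau, e_r] on {tau <= e_r}; hence it is at most U(x), with equality when X stays
   below x_S before tau, since Q_S vanishes there. Reflecting X gives the same for D
   with x_I. So for rho = min(sigma_I, tau) the part D is stopped with equality and U
   with inequality, which yields M_x(sigma_I, tau) <= V(x), and symmetrically
   M_x(sigma, tau_S) >= V(x): (sigma_I, tau_S) is a saddle point.

   The strong Markov property is avoided. On the grid of mesh h = 1/(m+1) the value of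
   the maximum over grid times is excessive for the random walk (X_{kh}), and harmonic
   below x_S; optional stopping for stopping times rounded up to the grid is then
   elementary. Grid times preceding the rounded time precede tau itself, so equality
   survives the rounding, and m is sent to infinity by dominated convergence. *)
Require Import Defs.
From HB Require Import structures.
From mathcomp Require Import all_boot all_order all_algebra.
From mathcomp Require Import all_classical all_reals all_analysis.
From mathcomp Require Import measurable_realfun lra.
Import Order.TTheory GRing.Theory Num.Theory.
Import numFieldNormedType.Exports.
Local Open Scope classical_set_scope.
Local Open Scope ring_scope.
Set Implicit Arguments. Unset Strict Implicit. Unset Printing Implicit Defensive.

(** * Independence and integrals *)

(** The clock [e] is independent of [L] only; the filtration may carry information on [e], so the
    memoryless property cannot be applied directly at a stopping time. Hence [e] is integrated out
    first: it enters only through values that are functions of the starting point, and the stopping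
    argument itself relies on increments of [L] being independent of [F]. Independence of [e] is
    moreover given for finitely many times of [L], which is exactly what a maximum over a finite
    grid needs. Two further obstacles shape the proof. The grid values must converge along moving
    points, since rounding a stopping time also moves the position; monotonicity and continuity of
    the limit supply this. And entry times into closed half-lines must be shown to be stopping
    times: completeness and right-continuity of the filtration give it through an essential supremum
    of stopping times. *)

Section measure_lemmas.
Context {d : measure_display} {Omega : measurableType d} {R : realType}.
Variable P : probability Omega R.

Lemma measurable_fun_select d' (T : measurableType d') (g : nat -> Omega -> T)
    (N : Omega -> nat) :
  (forall k, measurable_fun setT (g k)) ->
  (forall k, measurable [set w | N w = k]) ->
  measurable_fun setT (fun w => g (N w) w).
Proof.
move=> mg mN.
have -> : [set: Omega] = \bigcup_k [set w | N w = k].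
  by apply/seteqP; split => // w _; exists (N w).
apply/measurable_fun_bigcup => // k.
have mgk : measurable_fun [set w | N w = k] (g k) by exact: measurable_funS (mg k).
by apply: eq_measurable_fun mgk => w; rewrite inE /= => ->.
Qed.

(** Both rounded stopping times and the rounded exponential time take countably many values; this
    turns their integrals into series over those values. *)
Lemma ge0_integral_select (g : nat -> Omega -> \bar R) (N : Omega -> nat) :
  (forall k, measurable_fun setT (g k)) -> (forall k w, (0 <= g k w)%E) ->
  (forall k, measurable [set w | N w = k]) ->
  (\int[P]_w g (N w) w = \sum_(0 <= k <oo) \int[P]_(w in [set w | N w = k]) g k w)%E.
Proof.
move=> mg g0 mN.
have E : [set: Omega] = \bigcup_k [set w | N w = k].
  by apply/seteqP; split => // w _; exists (N w).
rewrite [in LHS]E ge0_integral_bigcup//.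
- apply: eq_eseriesr => k _; apply: eq_integral => w; rewrite inE /= => Nw.
  by rewrite Nw.
- by rewrite -E; exact: measurable_fun_select.
- by apply/trivIsetP => i j _ _ ij; apply/seteqP; split => // w /= [->] /eqP; rewrite (negPf ij).
Qed.

(** The variable [xi'] is a second one with the law of [xi]: in the Markov step it is [L h]
    replacing an increment, so one hypothesis absorbs independence and stationarity. The product
    rule on rectangles determines the law of the pair, and Tonelli concludes. *)
Lemma ge0_integral_pair_indep d' (T : measurableType d') (Z : Omega -> T)
    (xi xi' : Omega -> R) (f : T * R -> \bar R) :
  measurable_fun setT Z -> measurable_fun setT xi -> measurable_fun setT xi' ->
  (forall A B, measurable A -> measurable B ->
    P (Z @^-1` A `&` xi @^-1` B) = (P (Z @^-1` A) * P (xi' @^-1` B))%E) ->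
  measurable_fun setT f -> (forall z, (0 <= f z)%E) ->
  (\int[P]_w f (Z w, xi w) = \int[P]_w \int[P]_w' f (Z w, xi' w'))%E.
Proof.
move=> mZ mxi mxi' ind mf f0.
pose X1 : {RV P >-> T} := HB.pack Z (@isMeasurableFun.Build _ _ _ _ Z mZ).
pose X2 : {RV P >-> R} := HB.pack xi' (@isMeasurableFun.Build _ _ _ _ xi' mxi').
have mZxi : measurable_fun setT (fun w => (Z w, xi w)) by exact: measurable_fun_pair.
pose X3 : {RV P >-> (T * R)%type} :=
  HB.pack (fun w => (Z w, xi w)) (@isMeasurableFun.Build _ _ _ _ _ mZxi).
have E := @product_measure_unique _ _ T R R (distribution P X1) (distribution P X2)
  (distribution P X3) ind.
transitivity (\int[distribution P X3]_z f z)%E; first by rewrite ge0_integral_distribution.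
transitivity (\int[(distribution P X1 \x distribution P X2)%E]_z f z)%E.
  by apply: eq_measure_integral => A mA _; symmetry; exact: E.
rewrite fubini_tonelli1// ge0_integral_distribution//=.
- apply: eq_integral => w _ /=; rewrite /fubini_F.
  rewrite (@ge0_integral_distribution _ _ _ _ _ P X2 (fun y => f (Z w, y)))//.
  exact: measurable_fun_pair2.
- exact: measurable_fun_fubini_tonelli_F.
- by move=> y; exact: integral_ge0.
Qed.

(** Open half-lines are stable under intersection and generate the Borel sets, so the product rule
    is only asked for them. For a maximum [X], such an event is a finite intersection of conditions
    on the path. *)
Lemma ge0_integral_event_indep (X : Omega -> R) (C : set Omega) (f : R -> \bar R) :
  measurable_fun setT X -> measurable C ->
  (forall c, P ([set w | X w < c] `&` C) = (P [set w | (X w < c)%R] * P C)%E) ->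
  measurable_fun setT f -> (forall z, (0 <= f z)%E) ->
  (\int[P]_(w in C) f (X w) = P C * \int[P]_w f (X w))%E.
Proof.
move=> mX mC ind mf f0.
pose k : {nonneg R} := NngNum (fine_ge0 (measure_ge0 P C)).
have kE : k%:num%:E = P C by rewrite /= fineK// fin_num_measure.
pose p1 : {measure set R -> \bar R} := pushforward (mrestr P mC) X.
pose p2 : {measure set R -> \bar R} := mscale k (pushforward P X).
pose m1 := p1 mX; pose m2 := p2 mX.
have E : forall A, measurable A -> m1 A = m2 A.
  apply: (@measure_unique _ R R (@RGenInftyO.G R) (fun n => `]-oo, n%:R[%classic) _ _ _ _ m1 m2).
  - exact: RGenInftyO.measurableE.
  - move=> _ _ [x ->] [y ->]; exists (Num.min x y); apply/seteqP; split => z /=.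
      by rewrite !in_itv/= lt_min => -[-> ->].
    by rewrite !in_itv/= lt_min => /andP.
  - by move=> n; exists n%:R.
  - apply/seteqP; split => // x _; exists (Num.truncn x).+1 => //=.
    by rewrite in_itv/= truncnS_gt.
  - move=> _ [x ->].
    have -> : m1 `]-oo, x[%classic = P ([set w | X w < x] `&` C) by [].
    have -> : m2 `]-oo, x[%classic = (k%:num%:E * P [set w | (X w < x)%R])%E by [].
    by rewrite kE muleC ind.
  - move=> n; have -> : m1 `]-oo, n%:R[%classic = P ([set w | X w < n%:R] `&` C) by [].
    apply: (@le_lt_trans _ _ (P C)); last by rewrite -ge0_fin_numE// fin_num_measure.
    have mXn : measurable [set w | X w < n%:R].
      by rewrite -[X in measurable X]setTI; apply: (mX measurableT `]-oo, n%:R[%classic).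
    by apply: le_measure; rewrite ?inE//; exact: measurableI.
have mfX : measurable_fun setT (f \o X) by exact: measurableT_comp.
transitivity (\int[mrestr P mC]_w f (X w))%E.
  rewrite (@ge0_negligible_integral _ _ _ _ setT (~` C))//; [|exact: measurableC|].
    rewrite setTD setCK; apply: eq_measure_integral => A mA AC.
    by rewrite /= /mrestr; apply/esym; congr (P _); apply/setIidPl.
  by rewrite /= /mrestr setICl measure0.
transitivity (\int[m1]_y f y)%E.
  rewrite ge0_integral_pushforward// => y _; exact: f0.
rewrite (eq_measure_integral m2); last by move=> A mA _; exact: E.
rewrite ge0_integral_mscale// kE ge0_integral_pushforward//.
Qed.
End measure_lemmas.

(** * Time grids and stopping times *)

Section grid.
Context {R : realType}.
Implicit Types (t u : R) (m k : nat).

Definition gtime m k : R := k%:R / m.+1%:R.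
(* Only meaningful for t >= 0, because of the absolute value. *)
Definition gceil m t : nat := `|Num.ceil (t * m.+1%:R)|%N.

Lemma gtime_ge0 m k : 0 <= gtime m k.
Proof. by rewrite divr_ge0. Qed.

Lemma gtime0 m : gtime m 0 = 0.
Proof. by rewrite /gtime mul0r. Qed.

Lemma gtimeS m k : gtime m k.+1 = gtime m k + gtime m 1.
Proof. by rewrite /gtime -mulrDl -natrD addn1. Qed.

Lemma gtime_le m k l : (gtime m k <= gtime m l) = (k <= l)%N.
Proof. by rewrite ler_pM2r ?invr_gt0// ler_nat. Qed.

Lemma gceil_le m t k : 0 <= t -> (gceil m t <= k)%N = (t <= gtime m k).
Proof.
move=> t0; rewrite /gtime ler_pdivlMr// /gceil.
have c0 : 0 <= Num.ceil (t * m.+1%:R) by rewrite ceil_ge0 (lt_le_trans (ltrN10 _))// mulr_ge0.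
rewrite -lez_nat gez0_abs// -[k%:R]/(k%:Z%:~R) ceil_le_int//.
Qed.

Lemma le_gtime_gceil m t : 0 <= t -> t <= gtime m (gceil m t).
Proof. by move=> t0; rewrite -gceil_le. Qed.

Lemma gtime_lt_gceil m t k : 0 <= t -> (k < gceil m t)%N = (gtime m k < t).
Proof. by move=> t0; rewrite ltnNge gceil_le// ltNge. Qed.

Lemma gtime_gceil_le m t : 0 <= t -> gtime m (gceil m t) <= t + m.+1%:R^-1.
Proof.
move=> t0; case: (posnP (gceil m t)) => [->|N0].
  by rewrite gtime0 addr_ge0.
rewrite -(prednK N0) gtimeS /gtime mul1r lerD2r -/(gtime _ _) ltW//.
by rewrite -gtime_lt_gceil// prednK.
Qed.

Lemma cvg_gtime_gceil t : 0 <= t -> gtime m (gceil m t) @[m --> \oo] --> t.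
Proof.
move=> t0; apply: (@squeeze_cvgr _ _ _ _ (fun=> t) (fun m => t + m.+1%:R^-1)).
- by apply: nearW => m; rewrite le_gtime_gceil// gtime_gceil_le.
- exact: cvg_cst.
- rewrite -[X in _ --> X]addr0; apply: cvgD; first exact: cvg_cst.
  exact: cvg_harmonic.
Qed.

(** Rounding is upward so that, at a grid time, the rounded time is still ahead exactly when the
    original one is; that event is therefore known at that grid time. *)
Definition gup m (u : \bar R) : \bar R :=
  if u is EFin t then (gtime m (gceil m t))%:E else u.

(* Index 0 encodes an infinite time, index k.+1 the grid time k. *)
Definition gindex m (u : \bar R) : nat :=
  if u is EFin t then (gceil m t).+1 else 0.

Definition eval_at {Omega : Type} (Z : R -> Omega -> R) (u : \bar R) (w : Omega) : R :=
  if u is EFin t then Z t w else 0.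

Definition right_continuous_paths {Omega : Type} (Z : R -> Omega -> R) :=
  forall w t, 0 <= t -> Z s w @[s --> t^'+] --> Z t w.

Lemma right_continuous_seq {Omega : Type} (Z : R -> Omega -> R) w t (s : nat -> R) :
  right_continuous_paths Z -> 0 <= t -> (forall n, t <= s n) ->
  s n @[n --> \oo] --> t -> Z (s n) w @[n --> \oo] --> Z t w.
Proof.
move=> rZ t0 ts st; apply/cvgrPdist_lt => /= eps eps0.
have /cvgrPdist_lt /(_ _ eps0) [/= dl dl0 H] := rZ w t t0.
move/cvgrPdist_lt : st => /(_ _ dl0); apply: filterS => n sn.
have := ts n; rewrite le_eqVlt => /predU1P[<-|tsn]; first by rewrite subrr normr0.
exact: H.
Qed.

Lemma cvg_eval_at_gup {Omega : Type} (Z : R -> Omega -> R) w (u : \bar R) :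
  right_continuous_paths Z -> (0 <= u)%E ->
  eval_at Z (gup m u) w @[m --> \oo] --> eval_at Z u w.
Proof.
move=> rZ; case: u => [t| |]//= t0; last exact: cvg_cst.
apply: (@right_continuous_seq _ Z w t (fun m => gtime m (gceil m t))) => //.
- by move=> n; exact: le_gtime_gceil.
- exact: cvg_gtime_gceil.
Qed.

End grid.

Section filtration.
Context {d : measure_display} {Omega : measurableType d} {R : realType}.
Variable F : R -> set (set Omega).
Hypothesis FF : filtration F.
Implicit Types (t : R) (tau : Omega -> \bar R).

Lemma filtration_le s t A : 0 <= s -> s <= t -> F s A -> F t A.
Proof. by move=> s0 st; case: FF => _ [_]; apply; rewrite s0. Qed.

Lemma filtration_measurable t A : 0 <= t -> F t A -> measurable A.
Proof. by move=> t0; case: FF => _ [H _]; apply: H. Qed.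

Lemma filtrationC t A : 0 <= t -> F t A -> F t (~` A).
Proof. by move=> t0; case: FF => /(_ _ t0)[_ H _] _ /H; rewrite setTD. Qed.

Lemma filtration_bigcup t (A : nat -> set Omega) :
  0 <= t -> (forall n, F t (A n)) -> F t (\bigcup_n A n).
Proof. by move=> t0; case: FF => /(_ _ t0)[_ _ H] _; apply: H. Qed.

Lemma filtration_bigcap t (A : nat -> set Omega) :
  0 <= t -> (forall n, F t (A n)) -> F t (\bigcap_n A n).
Proof.
move=> t0 FA; rewrite -[X in F t X]setCK setC_bigcap; apply: filtrationC => //.
by apply: filtration_bigcup => // n; exact: filtrationC.
Qed.

Lemma filtrationU t A B : 0 <= t -> F t A -> F t B -> F t (A `|` B).
Proof.
move=> t0 FA FB; rewrite -bigcup2E; apply: filtration_bigcup => // -[|[|n]]//=.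
by case: FF => /(_ _ t0)[].
Qed.

Lemma filtrationI t A B : 0 <= t -> F t A -> F t B -> F t (A `&` B).
Proof.
move=> t0 FA FB; rewrite -[X in F t X]setCK setCI; apply: filtrationC => //.
by apply: filtrationU => //; exact: filtrationC.
Qed.

Lemma filtrationT t : 0 <= t -> F t setT.
Proof.
by move=> t0; rewrite -setC0; apply: filtrationC => //; case: FF => /(_ _ t0)[].
Qed.

Lemma stopping_time_gt tau t : stopping_time F tau -> 0 <= t ->
  F t [set w | (t%:E < tau w)%E].
Proof.
move=> [_ st] t0; rewrite (_ : [set _ | _] = ~` [set w | (tau w <= t%:E)%E]).
  by apply: filtrationC => //; exact: st.
by apply/seteqP; split => w /=; rewrite ltNge => /negP.
Qed.

Lemma measurable_stopping_time tau : stopping_time F tau -> measurable_fun setT tau.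
Proof.
move=> st; apply: (measurability (@ErealGenOInfty.G R)).
  exact: ErealGenOInfty.measurableE.
move=> _ [_ [x ->] <-]; rewrite setTI.
rewrite (_ : _ @^-1` _ = [set w | (x%:E < tau w)%E]); last first.
  by apply/seteqP; split => w /=; rewrite in_itv/= andbT.
have [x0|x0] := leP 0 x.
  by apply: (filtration_measurable x0); exact: stopping_time_gt.
rewrite (_ : [set _ | _] = setT)//; apply/seteqP; split => // w _ /=.
by apply: (@lt_le_trans _ _ 0%E); [rewrite lte_fin|case: st].
Qed.

Lemma stopping_time_min sigma tau : stopping_time F sigma -> stopping_time F tau ->
  stopping_time F (fun w => Order.min (sigma w) (tau w)).
Proof.
move=> [s0 sF] [t0 tF]; split => [w|t ge0]; first by rewrite le_min s0 t0.
rewrite (_ : [set _ | _] = [set w | (sigma w <= t%:E)%E] `|` [set w | (tau w <= t%:E)%E]).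
  by apply: filtrationU => //; [exact: sF|exact: tF].
by apply/seteqP; split => w /=; rewrite ge_min => /orP.
Qed.

Lemma stopping_time_sup (tau : nat -> Omega -> \bar R) :
  (forall n, stopping_time F (tau n)) ->
  stopping_time F (fun w => ereal_sup (range (tau ^~ w))).
Proof.
move=> st; split => [w|t t0].
  have [/(_ w) h _] := st 0; apply: (le_trans h).
  by apply: ereal_sup_ubound; exists 0.
rewrite (_ : [set _ | _] = \bigcap_n [set w | (tau n w <= t%:E)%E]).
  by apply: filtration_bigcap => // n; case: (st n) => _; apply.
apply/seteqP; split => w /= H.
  by move=> n _ /=; apply: le_trans H; apply: ereal_sup_ubound; exists n.
by apply: ge_ereal_sup => _ [n _ <-]; exact: H.
Qed.

Lemma measurable_gindex tau m k : measurable_fun setT tau -> (forall w, (0 <= tau w)%E) ->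
  measurable [set w | gindex m (tau w) = k].
Proof.
move=> mt t0.
have mle x : measurable [set w | (tau w <= x)%E].
  by rewrite -[X in measurable X]setTI; exact: emeasurable_fun_infty_c.
have H j : measurable [set w | gindex m (tau w) = j.+1].
  have -> : [set w | gindex m (tau w) = j.+1] =
      [set w | (tau w <= (gtime m j)%:E)%E] `\`
      (if j is i.+1 then [set w | (tau w <= (gtime m i)%:E)%E] else set0).
    apply/seteqP; split => w /=; have := t0 w; case E0: (tau w) => [t| |]//= tge0.
    + move=> [E]; rewrite lee_fin -gceil_le// E leqnn; split => //.
      by case: j E => [|i] E; [case|rewrite /= E0 lee_fin -gceil_le// E ltnn].
    + move=> [tj]; rewrite lee_fin -gceil_le// in tj; case: j tj => [|i] tj.
        by move: tj; rewrite leqn0 => /eqP ->.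
      rewrite /= E0 lee_fin -gceil_le// => /negP; rewrite -ltnNge => ti.
      by congr S; apply/eqP; rewrite eqn_leq tj ti.
    + by move=> [].
  by apply: measurableD => //; case: j.
case: k => // ; rewrite (_ : [set _ | _] = ~` \bigcup_j [set w | gindex m (tau w) = j.+1]).
  by apply: measurableC; exact: bigcup_measurable.
apply/seteqP; split => w /=; first by move=> E [j _] /=; rewrite E.
by move=> H'; case E : (gindex m (tau w)) => [//|j]; exfalso; apply: H'; exists j.
Qed.

Lemma measurable_eval_at_gup (Z : R -> Omega -> R) tau m :
  (forall t, 0 <= t -> measurable_fun setT (Z t)) ->
  measurable_fun setT tau -> (forall w, (0 <= tau w)%E) ->
  measurable_fun setT (fun w => eval_at Z (gup m (tau w)) w).
Proof.
move=> mZ mt t0.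
pose g k w := if k is j.+1 then Z (gtime m j) w else 0.
rewrite (_ : (fun _ => _) = (fun w => g (gindex m (tau w)) w)); last first.
  by apply/funext => w; case: (tau w).
apply: measurable_fun_select => [[|j]|k]; first exact: measurable_cst.
  exact/mZ/gtime_ge0.
exact: measurable_gindex.
Qed.

Lemma measurable_eval_at (Z : R -> Omega -> R) tau :
  right_continuous_paths Z -> (forall t, 0 <= t -> measurable_fun setT (Z t)) ->
  measurable_fun setT tau -> (forall w, (0 <= tau w)%E) ->
  measurable_fun setT (fun w => eval_at Z (tau w) w).
Proof.
move=> rZ mZ mt t0.
apply: (@measurable_fun_cvg _ _ _ _ (fun m w => eval_at Z (gup m (tau w)) w)).
  by move=> m; exact: measurable_eval_at_gup.
by move=> w _; exact: cvg_eval_at_gup.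
Qed.
End filtration.

(** * Entry times of right-continuous adapted processes *)

Section entry_times.
Context {d : measure_display} {Omega : measurableType d} {R : realType}.
Variables (P : probability Omega R) (F : R -> set (set Omega)).
Hypothesis UF : usual_conditions P F.
Variable Y : R -> Omega -> R.
Hypothesis rY : right_continuous_paths Y.
Hypothesis aY : forall (t : R) (B : set R), 0 <= t -> measurable B -> F t (Y t @^-1` B).
Let FF : filtration F := proj1 UF.

Definition entry_time (a : R) (w : Omega) : \bar R :=
  ereal_inf [set t%:E | t in [set t | 0 <= t /\ Y t w <= a]].

Definition next_entry_time (T : Omega -> \bar R) (c : R) (w : Omega) : \bar R :=
  ereal_inf [set t%:E | t in [set t | [/\ 0 <= t, (T w <= t%:E)%E & Y t w < c]]].

(** This is where right-continuity of [F] enters. For a fixed [s > t], the margins [(s - t) / n.+1]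
    shrink to 0 while keeping every approximating event inside [F s]. *)
Lemma stopping_time_of_lt (tau : Omega -> \bar R) :
  (forall w, (0 <= tau w)%E) ->
  (forall t, 0 <= t -> F t [set w | (tau w < t%:E)%E]) -> stopping_time F tau.
Proof.
move=> t0 H; split => // t tge0; case: UF => _ [rF _]; apply: rF => // s ts.
have st0 : 0 < s - t by rewrite subr_gt0.
have pos n : 0 < (s - t) / n.+1%:R by rewrite divr_gt0.
rewrite (_ : [set _ | _] =
    \bigcap_n [set w | (tau w < (t + (s - t) / n.+1%:R)%:E)%E]).
  have s0 : 0 <= s by apply: le_trans (ltW ts).
  apply: (filtration_bigcap FF) => // n.
  apply: (@filtration_le _ _ _ _ FF (t + (s - t) / n.+1%:R)); last 1 first.
  - by apply: H; rewrite addr_ge0// ltW.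
  - by rewrite addr_ge0// ltW.
  - by rewrite -lerBrDl ler_pdivrMr// ler_peMr// ?ler1n// ltW.
apply/seteqP; split => w /= H'.
  by move=> n _; apply: le_lt_trans H' _; rewrite lte_fin ltrDl.
apply/lee_addgt0Pr => e e0.
pose n := Num.truncn ((s - t) / e).
apply: (le_trans (ltW (H' n Logic.I))).
rewrite -EFinD lee_fin lerD2l ler_pdivrMr// mulrC -ler_pdivrMr//.
exact/ltW/truncnS_gt.
Qed.

Lemma entry_time_ge0 a w : (0 <= entry_time a w)%E.
Proof. by apply: le_ereal_inf_tmp => _ [t [t0 _] <-]; rewrite lee_fin. Qed.

Lemma lt_entry_time a w t : 0 <= t -> (t%:E < entry_time a w)%E -> a < Y t w.
Proof.
move=> t0; rewrite !ltNge; apply: contra => Yt.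
by apply: ereal_inf_lbound; exists t.
Qed.

(** An infimum of times is approached from the right, so right-continuity alone carries the closed
    condition to the limit. *)
Lemma ereal_inf_times_le (S : set R) c w t : 0 <= t ->
  ereal_inf [set s%:E | s in S] = t%:E -> (forall s, S s -> Y s w <= c) -> Y t w <= c.
Proof.
move=> t0 E YS.
have H n : exists s, [/\ t <= s, s <= t + n.+1%:R^-1 & Y s w <= c].
  have n0 : 0 < n.+1%:R^-1 :> R by rewrite invr_gt0.
  have Sfin : ereal_inf [set s%:E | s in S] \is a fin_num by rewrite E.
  have [_ [s Ss <-]] := lb_ereal_inf_adherent n0 Sfin.
  rewrite E -EFinD lte_fin => sn; exists s; split; [|exact: ltW|exact: YS].
  by rewrite -lee_fin -E; apply: ereal_inf_lbound; exists s.
have [s sP] := choice H.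
have : Y (s n) w @[n --> \oo] --> Y t w.
  apply: right_continuous_seq => //; first by move=> n; case: (sP n).
  apply: (@squeeze_cvgr _ _ _ _ (fun=> t) (fun m => t + m.+1%:R^-1)).
  - by apply: nearW => m; case: (sP m) => -> ->.
  - exact: cvg_cst.
  - rewrite -[X in _ --> X]addr0; apply: cvgD; first exact: cvg_cst.
    exact: cvg_harmonic.
move=> cv; apply: (cvgr_to_le cv).
by apply: nearW => n; case: (sP n).
Qed.

Lemma entry_time_attained a w t : entry_time a w = t%:E -> Y t w <= a.
Proof.
move=> E; have t0 : 0 <= t by rewrite -lee_fin -E entry_time_ge0.
by apply: (ereal_inf_times_le t0 E) => s [].
Qed.

Lemma next_entry_time_ge T c w : (T w <= next_entry_time T c w)%E.
Proof. by apply: le_ereal_inf_tmp => _ [t [t0 Tt _] <-]. Qed.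

Lemma next_entry_time_attained T c w t : 0 <= t ->
  next_entry_time T c w = t%:E -> Y t w <= c.
Proof. by move=> t0 E; apply: (ereal_inf_times_le t0 E) => s [_ _ /ltW]. Qed.

(** The strict condition [Y s w < c] at some [s < t] persists on a short interval to the right of
    [s], hence is seen at a grid time before [t]. So the event of entry before [t] is a countable
    union of events of [F t]. *)
Lemma stopping_time_next_entry T c : stopping_time F T ->
  stopping_time F (next_entry_time T c).
Proof.
move=> [T0 TF]; apply: stopping_time_of_lt => [w|t t0].
  exact: le_trans (T0 w) (next_entry_time_ge _ _ _).
rewrite (_ : [set _ | _] = \bigcup_m \bigcup_k
   (if gtime m k < t :> R then [set w | (T w <= (gtime m k)%:E)%E] `&` (Y (gtime m k) @^-1` `]-oo, c[)
    else set0)).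
  apply: (filtration_bigcup FF) => // m; apply: (filtration_bigcup FF) => // k.
  case: ifPn => [kt|_]; last by case: FF => /(_ _ t0)[].
  apply: (filtrationI FF) => //; apply: (filtration_le FF (gtime_ge0 m k)) => //; try exact: ltW.
    exact/TF/gtime_ge0.
  apply: aY => //; exact: gtime_ge0.
apply/seteqP; split => w /=.
  move=> /ereal_inf_lt[_ [s [s0 Ts Ys] <-]]; rewrite lte_fin => st.
  have cg := cvg_gtime_gceil s0.
  have cY : Y (gtime m (gceil m s)) w @[m --> \oo] --> Y s w.
    by apply: right_continuous_seq => // n; exact: le_gtime_gceil.
  near \oo => m.
  exists m => //; exists (gceil m s) => //.
  have -> : gtime m (gceil m s) < t by near: m; exact: cvgr_lt cg _ _.
  split => /=; first by apply: (le_trans Ts); rewrite lee_fin le_gtime_gceil.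
  by rewrite in_itv/=; near: m; exact: cvgr_lt cY _ _.
move=> [m _ [k _]]; case: ifPn => // kt [/= Tk]; rewrite in_itv/= => Yk.
apply: (@le_lt_trans _ _ (gtime m k)%:E); last by rewrite lte_fin.
by apply: ereal_inf_lbound; exists (gtime m k) => //; split => //; exact: gtime_ge0.
Unshelve. all: by end_near.
Qed.

(** A strictly decreasing bounded image of the times, with value 0 at infinity: two ordered times
    whose images have equal expectation agree almost surely. *)
Let decay (T : Omega -> \bar R) w : R := eval_at (fun t (_ : Omega) => expR (- t)) (T w) w.

Let decay_ge0 T w : 0 <= decay T w.
Proof. by rewrite /decay; case: (T w) => //= t; exact: expR_ge0. Qed.

Let decay_le1 T w : (0 <= T w)%E -> decay T w <= 1.
Proof.
by rewrite /decay; case: (T w) => //= t; rewrite lee_fin => t0; rewrite -expR0 ler_expR lerNl oppr0.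
Qed.

Let le_decay T T' w : (0 <= T w)%E -> (T w <= T' w)%E -> decay T' w <= decay T w.
Proof.
rewrite /decay; case: (T w) => [t| |]//= t0; case: (T' w) => [t'| |]//=.
by rewrite lee_fin ler_expR lerN2.
Qed.

Let decay_inj T T' w : (0 <= T w)%E -> (T w <= T' w)%E -> decay T w <= decay T' w ->
  T w = T' w.
Proof.
rewrite /decay; case: (T w) => [t| |]//= t0; case: (T' w) => [t'| |]//=; last first.
  by move=> _; rewrite leNgt expR_gt0.
by rewrite lee_fin ler_expR lerN2 => tt' t't; congr EFin; apply/eqP; rewrite eq_le tt' t't.
Qed.

Let measurable_decay T : stopping_time F T -> measurable_fun setT (decay T).
Proof.
move=> sT; apply: measurable_eval_at.
- move=> w t t0; apply: cvg_at_right_filter.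
  have : {for t, continuous (expR \o (@GRing.opp R))}.
    by apply: continuous_comp; [exact: opp_continuous|exact: continuous_expR].
  exact.
- by move=> t _; exact: measurable_cst.
- exact: (measurable_stopping_time FF).
- by case: sT.
Qed.

Let integrable_decay T : stopping_time F T -> P.-integrable setT (EFin \o decay T).
Proof.
move=> sT; apply: (@le_integrable _ _ _ P setT _ _ (cst 1%E)) => //.
- exact/measurable_EFinP/measurable_decay.
- move=> w _ /=; rewrite ger0_norm// lee_fin normr1 decay_le1//; by case: sT.
- exact: finite_measure_integrable_cst.
Qed.

Let phi T := (\int[P]_w (decay T w)%:E)%E.

(* T is an essential supremum of the stopping times below the entry time, found by
   minimizing E[exp(-T)]. *)
Lemma maximal_stopping_time a : exists T, [/\ stopping_time F T,
  forall w, (T w <= entry_time a w)%E &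
  forall T', stopping_time F T' -> (forall w, (T w <= T' w <= entry_time a w)%E) ->
    {ae P, forall w, T w = T' w}].
Proof.
pose C := [set T | stopping_time F T /\ forall w, (T w <= entry_time a w)%E].
pose I := ereal_inf [set phi T | T in C].
have C0 : C (cst 0%E).
  split; last by move=> w; exact: entry_time_ge0.
  split => // t t0; rewrite (_ : [set _ | _] = setT); first exact: (filtrationT FF).
  by apply/seteqP; split => // w _ /=; rewrite lee_fin.
have phi_ge0 T : (0 <= phi T)%E by apply: integral_ge0 => w _; rewrite lee_fin.
have Ifin : I \is a fin_num.
  rewrite ge0_fin_numE; last by apply: le_ereal_inf_tmp => _ [T _ <-].
  apply: (@le_lt_trans _ _ (phi (cst 0%E))); first by apply: ereal_inf_lbound; exists (cst 0%E).
  have /integrable_lty := integrable_decay (proj1 C0); apply.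
  exact: measurableT.
have H n : exists T, C T /\ (phi T < I + n.+1%:R^-1%:E)%E.
  have n0 : 0 < n.+1%:R^-1 :> R by rewrite invr_gt0.
  by have [_ [T CT <-] lt] := lb_ereal_inf_adherent n0 Ifin; exists T.
have [Tn TnP] := choice H.
pose T w := ereal_sup (range (Tn ^~ w)).
have sT : stopping_time F T by apply: (stopping_time_sup FF) => n; case: (TnP n) => -[].
have leT w : (T w <= entry_time a w)%E.
  by apply: ge_ereal_sup => _ [n _ <-]; case: (TnP n) => -[].
have phiT : (phi T <= I)%E.
  apply/lee_addgt0Pr => e e0.
  pose n := Num.truncn e^-1.
  have [[sTn _] lt] := TnP n.
  apply: (@le_trans _ _ (phi (Tn n))).
    apply: le_integral => //; [exact: integrable_decay|exact: integrable_decay|].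
    move=> w _; rewrite lee_fin; apply: le_decay; first by case: sTn.
    by apply: ereal_sup_ubound; exists n.
  apply: (le_trans (ltW lt)); rewrite leeD2l// lee_fin.
  by rewrite -[leRHS]invrK lef_pV2 ?posrE ?invr_gt0// ltW// truncnS_gt.
exists T; split => // T' sT' TT'.
have T0 w : (0 <= T w)%E by case: sT.
have le' w : decay T' w <= decay T w by apply: le_decay => //; case/andP: (TT' w).
(* [T'] is itself a competitor, so [phi T'] is at least the infimum, hence at least [phi T]; the
   order [T <= T'] gives the reverse inequality. *)
have E : (\int[P]_w `|(decay T w)%:E - (decay T' w)%:E| = 0)%E.
  transitivity (phi T - phi T')%E.
    rewrite -integralB//; [|exact: integrable_decay|exact: integrable_decay].
    by apply: eq_integral => w _; rewrite gee0_abs// -EFinB lee_fin subr_ge0.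
  have phi'fin : phi T' \is a fin_num.
    rewrite ge0_fin_numE//.
    by have /integrable_lty := integrable_decay sT'; apply; exact: measurableT.
  apply/eqP; rewrite eq_le; apply/andP; split.
    rewrite lee_subel_addl// adde0 (le_trans phiT)//; apply: ereal_inf_lbound.
    by exists T' => //; split => // w; case/andP: (TT' w).
  rewrite sube_ge0 ?phi'fin//; apply: le_integral => //; [exact: integrable_decay|exact: integrable_decay|].
  by move=> w _; rewrite lee_fin.
have m1 : measurable_fun setT (fun w => (decay T w)%:E - (decay T' w)%:E)%E.
  by apply: emeasurable_funB; apply/measurable_EFinP; exact: measurable_decay.
move/(ae_eq_integral_abs P measurableT m1) : E; apply: filterS => w /(_ Logic.I) /= E.
apply: decay_inj => //; first by case/andP: (TT' w).
by move: E => [] /eqP; rewrite subr_eq0 => /eqP ->.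
Qed.

(* Left limits could touch the level without the path doing so. Maximality handles
   this: the first time after T at which Y < a + 1/(n+1) is again a stopping time
   below the entry time, hence equal to T almost surely, so that Y_T <= a. *)
Lemma stopping_time_entry_time a : stopping_time F (entry_time a).
Proof.
have [T [sT leT maxT]] := maximal_stopping_time a.
have [T0 TF] := sT.
pose c n := a + n.+1%:R^-1.
have ac n : a < c n by rewrite ltrDl invr_gt0.
have nextle n w : (next_entry_time T (c n) w <= entry_time a w)%E.
  case E : (entry_time a w) => [t| |]; last 2 first.
  - exact: leey.
  - by have := entry_time_ge0 a w; rewrite E.
  have t0 : 0 <= t by rewrite -lee_fin -E entry_time_ge0.
  apply: ereal_inf_lbound; exists t => //; split => //; first by rewrite -E.
  exact: le_lt_trans (entry_time_attained E) (ac n).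
have aeT : {ae P, forall w, T w = entry_time a w}.
  have : {ae P, forall w, forall n, T w = next_entry_time T (c n) w}.
    apply/ae_foralln => n; apply: maxT; first exact: stopping_time_next_entry.
    by move=> w; rewrite next_entry_time_ge nextle.
  apply: filterS => w Tw; apply/eqP; rewrite eq_le leT/=.
  case E : (T w) => [t| |]; last 2 first.
  - exact: leey.
  - by have := T0 w; rewrite E.
  have t0 : 0 <= t by rewrite -lee_fin -E.
  apply: ereal_inf_lbound; exists t => //; split => //.
  have cc : c n @[n --> \oo] --> a.
    rewrite -[X in _ --> X]addr0; apply: cvgD; first exact: cvg_cst.
    exact: cvg_harmonic.
  apply: (cvgr_to_ge cc); apply: nearW => n.
  by apply: (@next_entry_time_attained T) => //; rewrite -Tw.
split => [w|t t0]; first exact: entry_time_ge0.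
(* The entry time is only almost surely equal to [T]; the discrepancy at level [t] is a null set,
   which completeness puts in [F 0]. *)
pose N := [set w | (T w <= t%:E)%E /\ (t%:E < entry_time a w)%E].
have FN : F t N.
  apply: (filtration_le FF (lexx 0) t0); case: UF => _ [_]; apply.
  case: aeT => A [mA A0 sA]; exists A; split => // w [Tw tw]; apply: sA => /= E.
  by move: tw; rewrite -E ltNge Tw.
rewrite (_ : [set _ | _] = [set w | (T w <= t%:E)%E] `&` ~` N).
  by apply: (filtrationI FF) => //; [exact: TF|exact: (filtrationC FF)].
apply/seteqP; split => w /=.
  by move=> le; split; [exact: le_trans (leT w) le|move=> [_]; rewrite ltNge le].
by move=> [Tw nN]; rewrite leNgt; apply/negP => lt; apply: nN.
Qed.

End entry_times.

(** * The running maximum on a grid *)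

Section levy_markov.
Context {d : measure_display} {Omega : measurableType d} {R : realType}.
Variables (P : probability Omega R) (F : R -> set (set Omega)) (L : R -> Omega -> R).
Hypotheses (FF : filtration F) (LL : levy_process P F L).

Lemma levy0 w : L 0 w = 0. Proof. by case: LL. Qed.

Lemma levy_adapted t (B : set R) : 0 <= t -> measurable B -> F t (L t @^-1` B).
Proof. by case: LL => _ [H _]; exact: H. Qed.

Lemma measurable_levy t : 0 <= t -> measurable_fun setT (L t).
Proof.
move=> t0 _ B mB; rewrite setTI; apply: (filtration_measurable FF t0).
exact: levy_adapted.
Qed.

Lemma levy_markov d' (T : measurableType d') (Z : Omega -> T) s h (f : T * R -> \bar R) :
  0 <= s -> 0 <= h -> (forall B, measurable B -> F s (Z @^-1` B)) ->
  measurable_fun setT f -> (forall z, (0 <= f z)%E) ->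
  (\int[P]_w f (Z w, (L (s + h) w - L s w)%R) = \int[P]_w \int[P]_w' f (Z w, L h w'))%E.
Proof.
move=> s0 h0 FZ mf f0; have sh : s <= s + h by rewrite lerDl.
apply: (@ge0_integral_pair_indep _ _ _ P _ _ Z (fun w => L (s + h) w - L s w)) => //.
- by move=> _ B mB; rewrite setTI; apply: (filtration_measurable FF s0); exact: FZ.
- by apply: measurable_funB; apply: measurable_levy => //; rewrite addr_ge0.
- exact: measurable_levy.
- case: LL => _ [_ [_ [_ [ind sta]]]] A B mA mB.
  have /= E := ind s (s + h) (Z @^-1` A) B _ (FZ _ mA) mB.
  have /= E' := sta s (s + h) B _ mB.
  rewrite [LHS]E ?s0//; congr (_ * _)%E; rewrite E' ?s0//.
  by rewrite addrAC subrr add0r.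
Qed.

Variables (Q : R -> R) (b : R).
Hypotheses (cQ : continuous Q) (ndQ : {homo Q : x y / x <= y})
  (Q0 : forall x, x <= b -> Q x = 0).
Implicit Types (a y : R) (m k : nat).

Lemma payoff_ge0 x : 0 <= Q x.
Proof.
have [xb|bx] := leP x b; first by rewrite Q0.
by rewrite -(Q0 (lexx b)); apply: ndQ; exact: ltW.
Qed.

Lemma payoff_max x : Q (Order.max b x) = Q x.
Proof. by case: leP => // bx; rewrite !Q0// ltW. Qed.

Lemma measurable_payoff : measurable_fun setT Q.
Proof. exact: continuous_measurable_fun. Qed.

(* At (a, y), the expectation of Q (max(a, y, y + L_h, ..., y + L_{kh})) with
   h = 1/(m+1). Carrying the running maximum a along with the position y is what
   makes one step of the process a Markov recursion. *)
Fixpoint expected_max m k (z : R * R) : \bar R :=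
  if k is k'.+1 then
    (\int[P]_w expected_max m k' (Order.max z.1 z.2, z.2 + L (gtime m 1) w)%R)%E
  else (Q (Order.max z.1 z.2))%:E.

Lemma expected_max_ge0 m k z : (0 <= expected_max m k z)%E.
Proof.
elim: k z => [|k IH] z /=; first by rewrite lee_fin payoff_ge0.
by apply: integral_ge0.
Qed.

Lemma measurable_expected_max m k : measurable_fun setT (expected_max m k).
Proof.
elim: k => [|k IH] /=.
  apply/measurable_EFinP; apply: (measurableT_comp measurable_payoff).
  by apply: measurable_maxr; [exact: measurable_fst|exact: measurable_snd].
pose f (p : (R * R) * Omega) :=
  expected_max m k (Order.max p.1.1 p.1.2, p.1.2 + L (gtime m 1) p.2).
apply: (@measurable_fun_fubini_tonelli_F _ _ _ _ _ P f); last first.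
  by move=> x; exact: expected_max_ge0.
apply: (measurableT_comp IH); apply: measurable_fun_pair.
  apply: measurable_maxr.
    exact: (measurableT_comp measurable_fst measurable_fst).
  exact: (measurableT_comp measurable_snd measurable_fst).
apply: measurable_funD.
  exact: (measurableT_comp measurable_snd measurable_fst).
apply: (measurableT_comp (measurable_levy _) measurable_snd).
exact: gtime_ge0.
Qed.

Lemma measurable_expected_max_shift m k a y :
  measurable_fun setT (fun w => expected_max m k (a, y + L (gtime m 1) w)).
Proof.
apply: (measurableT_comp (measurable_expected_max m k)).
apply: measurable_fun_pair; first exact: measurable_cst.
apply: measurable_funD; first exact: measurable_cst.
exact/measurable_levy/gtime_ge0.
Qed.

Lemma le_expected_max m k a a' y y' : a <= a' -> y <= y' ->
  (expected_max m k (a, y) <= expected_max m k (a', y'))%E.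
Proof.
elim: k a a' y y' => [|k IH] a a' y y' aa' yy' /=.
  by rewrite lee_fin; apply: ndQ; rewrite ge_max !le_max aa' yy' orbT.
apply: ge0_le_integral => //.
- by move=> w _; exact: expected_max_ge0.
- exact: measurable_expected_max_shift.
- exact: measurable_expected_max_shift.
- by move=> w _; apply: IH; [rewrite ge_max !le_max aa' yy' orbT|rewrite lerD2r].
Qed.

Lemma expected_max_max m k a y :
  expected_max m k (Order.max a y, y) = expected_max m k (a, y).
Proof. by case: k => [|k] /=; rewrite -maxA maxxx. Qed.

(* Taking the maximum with b is harmless, Q being 0 below b, and lets the
   recursion start at a = b for every y. *)
Fixpoint grid_max m y k (w : Omega) : R :=
  if k is k'.+1 then Order.max (grid_max m y k' w) (y + L (gtime m k) w)
  else Order.max b (y + L 0 w).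

(** Rewrites an event on the maximum as finitely many conditions on [L] at grid times, the shape of
    the events in [indep_of_process]. The conjunct [b < c] comes from the floor [b] of the
    maximum. *)
Lemma grid_max_lt m y k w c : (grid_max m y k w < c) =
  (b < c) && [forall j : 'I_k.+1, y + L (gtime m j) w < c].
Proof.
elim: k => [|k IH] /=.
  rewrite gt_max; congr (_ && _); apply/idP/forallP => [H j|/(_ ord0)].
    by rewrite ord1 gtime0.
  by rewrite gtime0.
rewrite gt_max IH -andbA; congr (_ && _); apply/andP/forallP => [[/forallP H H'] j|H].
  case: (ltnP j k.+1) => jk; first exact: (H (Ordinal jk)).
  suff -> : (j : nat) = k.+1 by [].
  by apply/eqP; rewrite eqn_leq jk andbT -ltnS ltn_ord.
split; last exact: (H ord_max).
by apply/forallP => j; have := H (widen_ord (leqnSn _) j).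
Qed.

Lemma le_grid_max m y k j w : (j <= k)%N -> y + L (gtime m j) w <= grid_max m y k w.
Proof.
elim: k => [|k IH]; first by rewrite leqn0 => /eqP ->; rewrite gtime0 /= le_max lexx orbT.
rewrite leq_eqVlt => /predU1P[->|]; first by rewrite /= le_max lexx orbT.
by rewrite ltnS => /IH; rewrite /= le_max => ->.
Qed.

Lemma grid_max_adapted m y k B : measurable B ->
  F (gtime m k) ((fun w => (grid_max m y k w, y + L (gtime m k) w)) @^-1` B).
Proof.
have t0 := gtime_ge0 m k.
(* [F (gtime m k)] is made the measurable structure of a copy of [Omega], so that the usual rules
   for sums and maxima prove adaptedness. *)
pose T := g_sigma_algebraType (F (gtime m k)).
have mL j : (j <= k)%N -> measurable_fun [set: T] (L (gtime m j)).
  move=> jk _ C mC; rewrite setTI; apply: sub_sigma_algebra.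
  apply: (filtration_le FF (gtime_ge0 m j)); first by rewrite gtime_le.
  by apply: levy_adapted => //; exact: gtime_ge0.
have mX j : (j <= k)%N -> measurable_fun [set: T] (fun w : T => y + L (gtime m j) w).
  move=> jk; have mc : measurable_fun [set: T] (fun _ : T => y) by exact: measurable_cst.
  exact: measurable_funD mc (mL _ jk).
have mG j : (j <= k)%N -> measurable_fun [set: T] (grid_max m y j).
  have mb : measurable_fun [set: T] (fun _ : T => b) by exact: measurable_cst.
  elim: j => [|j IH] jk.
    by have := measurable_maxr mb (mX _ jk); rewrite gtime0.
  exact: measurable_maxr (IH (ltnW jk)) (mX _ jk).
have mZ : measurable_fun [set: T] (fun w => (grid_max m y k w, y + L (gtime m k) w)).
  by apply: measurable_fun_pair; [exact: mG|exact: mX].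
move=> mB; have := mZ measurableT _ mB; rewrite setTI.
by rewrite /measurable /= sigma_algebra_id//; case: FF => H _; exact: H.
Qed.

Lemma measurable_grid_max m y k : measurable_fun setT (grid_max m y k).
Proof.
elim: k => [|k IH] /=; apply: measurable_maxr => //; apply: measurable_funD => //;
  apply: measurable_levy => //; exact: gtime_ge0.
Qed.

(** A Chapman-Kolmogorov identity: [i] steps followed along the path and [k] steps averaged amount
    to [k + i] averaged steps. For [k = 0] it identifies the recursion with the expectation of [Q]
    at the grid maximum. *)
Lemma integral_expected_max m y k i :
  (\int[P]_w expected_max m k (grid_max m y i w, (y + L (gtime m i) w)%R) =
  expected_max m (k + i) (b, y))%E.
Proof.
elim: i k => [|i IH] k.
  rewrite addn0 -[RHS]mule1 -(probability_setT P) -integral_cst//.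
  by apply: eq_integral => w _ /=; rewrite gtime0 levy0 addr0 expected_max_max.
rewrite addnS -addSn -IH /= gtimeS.
transitivity (\int[P]_w expected_max m k (grid_max m y i w, (y + L (gtime m i) w +
    (L (gtime m i + gtime m 1) w - L (gtime m i) w))%R))%E.
  by apply: eq_integral => w _; rewrite expected_max_max -addrA subrKC.
pose f (z : (R * R) * R) := expected_max m k (z.1.1, z.1.2 + z.2).
rewrite (@levy_markov _ _ (fun w => (grid_max m y i w, y + L (gtime m i) w)) _ _ f)//.
- apply: eq_integral => w _; apply: eq_integral => w' _; rewrite /f /=; congr (expected_max _ _ (_, _)).
  by apply/esym/max_idPl; exact: le_grid_max.
- exact: gtime_ge0.
- exact: gtime_ge0.
- by move=> B; exact: grid_max_adapted.
- apply: (measurableT_comp (measurable_expected_max m k)); apply: measurable_fun_pair.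
    exact: (measurableT_comp measurable_fst measurable_fst).
  apply: measurable_funD; last exact: measurable_snd.
  exact: (measurableT_comp measurable_snd measurable_fst).
- by move=> z; exact: expected_max_ge0.
Qed.

End levy_markov.

Lemma nneseriesS (R : realType) (f : nat -> \bar R) : (forall k, (0 <= f k)%E) ->
  (\sum_(0 <= k <oo) f k = f 0%N + \sum_(0 <= k <oo) f k.+1)%E.
Proof.
move=> f0; rewrite nneseries_recl//; congr (_ + _)%E.
rewrite -nneseries_addn//.
by apply: eq_eseriesr => k _; rewrite addn1.
Qed.

(** The real [sup] of an unbounded set is a default value, so [Sup_e] can be compared with the path
    only once the path is known to be bounded above on compact intervals. *)
Lemma cadlag_bounded (R : realType) (f : R -> R) (T : R) :
  (forall t, 0 <= t -> f s @[s --> t^'+] --> f t) ->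
  (forall t, 0 < t -> exists l : R, f s @[s --> t^'-] --> l) ->
  exists M, forall t, 0 <= t <= T -> f t <= M.
Proof.
move=> rf lf.
have /compact_near_coveringP cK := @segment_compact R 0 T.
(* In the near-covering form of compactness, the filter of large [M] makes the local bounds uniform.
   The guard [0 <= t] discards the negative times close to 0. *)
have [|M [_ HM]] := cK R (pinfty_nbhs R) (fun M t => 0 <= t -> f t <= M) _; last first.
  exists (M + 1) => t /andP[t0 tT]; apply: (HM (M + 1)) => //; first by rewrite ltrDl.
  by rewrite /= in_itv/= t0.
move=> t; rewrite /= in_itv/= => /andP[t0 tT].
have [M [Mt Mr Ml]] : exists M, [/\ f t <= M,
    \forall s \near t^'+, f s <= M & \forall s \near t^'-, 0 <= s -> f s <= M].
  have Mr : \forall s \near t^'+, f s <= f t + 1.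
    by near=> s; apply: ltW; near: s; apply: (cvgr_lt _ (rf t t0)); rewrite ltrDl.
  have [tgt0|tle0] := ltP 0 t; last first.
    exists (f t + 1); split => //; first by rewrite lerDl.
    near=> s; move=> s0; exfalso; have : s < t by near: s; exact: nbhs_left_lt.
    by rewrite ltNge (le_trans tle0).
  have [l lP] := lf t tgt0; exists (Order.max (f t + 1) (l + 1)); split.
  - by rewrite le_max lerDl ler01.
  - by apply: filterS Mr => s sM; rewrite le_max sM.
  - near=> s => _; rewrite le_max; apply/orP; right; apply: ltW.
    by near: s; apply: (cvgr_lt _ lP); rewrite ltrDl.
move: Mr Ml; rewrite /at_right /at_left !near_withinE => Mr Ml.
exists ([set s | 0 <= s -> f s <= M], [set M' | M < M']) => /=.
  split; last by exists M; split => //; exact: num_real.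
  near=> s => /= s0; have [ts|st|<-//] := ltgtP t s.
    by move: ts; near: s.
  by move: st s0; near: s; apply: filterS Ml => s H st s0; exact: H.
by move=> [s M'] [/= H /ltW MM'] s0; apply: le_trans MM'; exact: H.
Unshelve. all: by end_near.
Qed.

(** * The value on a grid: one-step inequality and link with the exponential time *)

Section discounted_value.
Context {d : measure_display} {Omega : measurableType d} {R : realType}.
Variables (P : probability Omega R) (F : R -> set (set Omega)) (L : R -> Omega -> R).
Hypotheses (FF : filtration F) (LL : levy_process P F L).
Variables (Q : R -> R) (b : R).
Hypotheses (cQ : continuous Q) (ndQ : {homo Q : x y / x <= y})
  (Q0 : forall x, x <= b -> Q x = 0).
Variables (r : R) (e : Omega -> R).
Hypotheses (r0 : 0 < r) (he : exponential_rv P r e) (hi : indep_of_process P e L).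
Implicit Types (y : R) (m k : nat).

Local Notation em m k y := (expected_max P L Q m k (b, y)).
Local Notation gm := (grid_max L b).

Let em_ge0 m k y : (0 <= em m k y)%E := expected_max_ge0 P L ndQ Q0 m k (b, y).

(** The probability that the exponential time falls in []gtime m k, gtime m k.+1]]. *)
Definition grid_weight m k : R :=
  expR (- (r * gtime m k)) - expR (- (r * gtime m k.+1)).

(** The expectation of [Q] at the grid maximum, run for an independent geometric number of steps.
    The series is used because it no longer refers to [e]. *)
Definition grid_value m y : \bar R :=
  (\sum_(0 <= k <oo) (grid_weight m k)%:E * em m k y)%E.

Lemma grid_weight_ge0 m k : 0 <= grid_weight m k.
Proof. by rewrite subr_ge0 ler_expR lerN2 ler_pM2l// gtime_le. Qed.

(** The lack of memory of the exponential law, in the only form that is needed. *)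
Lemma grid_weightS m k :
  grid_weight m k.+1 = expR (- (r * gtime m 1)) * grid_weight m k.
Proof.
by rewrite /grid_weight mulrBr -!expRD -!opprD -!mulrDr ![gtime m 1 + _]addrC -!gtimeS.
Qed.

Let term_ge0 m k j y : (0 <= (grid_weight m k)%:E * em m j y)%E.
Proof. by rewrite mule_ge0// lee_fin grid_weight_ge0. Qed.

Lemma grid_value_ge0 m y : (0 <= grid_value m y)%E.
Proof. by apply: nneseries_ge0 => k _ _; exact: term_ge0. Qed.

Lemma le_grid_value m y y' : y <= y' -> (grid_value m y <= grid_value m y')%E.
Proof.
move=> yy'; apply: lee_nneseries => [k _ _|k _]; first exact: term_ge0.
rewrite lee_wpmul2l ?lee_fin ?grid_weight_ge0//.
exact: (le_expected_max FF LL cQ ndQ Q0).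
Qed.

Let measurable_em m k : measurable_fun setT (fun y => em m k y).
Proof.
exact: (measurableT_comp (measurable_expected_max FF LL cQ ndQ Q0 m k)
  (measurable_fun_pair (measurable_cst _) (@measurable_id _ _ setT))).
Qed.

Lemma measurable_grid_value m : measurable_fun setT (grid_value m).
Proof.
apply: ge0_emeasurable_sum => [k y _ _|k _]; first exact: term_ge0.
apply: emeasurable_funM => //.
Qed.

Let measurable_shift m y : measurable_fun setT (fun w => y + L (gtime m 1) w).
Proof.
apply: measurable_funD; first exact: measurable_cst.
exact/(measurable_levy FF LL)/gtime_ge0.
Qed.

Let discounted_grid_value m y :
  ((expR (- (r * gtime m 1)))%:E * \int[P]_w grid_value m (y + L (gtime m 1) w)%R =
  \sum_(0 <= k <oo) (grid_weight m k.+1)%:E * \int[P]_w em m k (y + L (gtime m 1) w)%R)%E.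
Proof.
have mem k : measurable_fun setT (fun w => em m k (y + L (gtime m 1) w)).
  exact: (measurableT_comp (measurable_em m k) (measurable_shift m y)).
rewrite integral_nneseries//.
- rewrite -nneseriesZl; last by move=> k _; apply: integral_ge0 => w _; exact: term_ge0.
  apply: eq_eseriesr => k _; rewrite ge0_integralZl//; last by rewrite lee_fin grid_weight_ge0.
  by rewrite muleA -EFinM -grid_weightS.
- by move=> k; exact: emeasurable_funM.
Qed.

(** Two losses cause the inequality: restarting after one step forgets the starting point [y] in the
    maximum, and the term of index 0 disappears. *)
Lemma grid_value_step m y :
  ((expR (- (r * gtime m 1)))%:E * \int[P]_w grid_value m (y + L (gtime m 1) w)%R
   <= grid_value m y)%E.
Proof.
rewrite discounted_grid_value [leRHS]nneseriesS; last by move=> k; exact: term_ge0.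
apply: (@le_trans _ _ (\sum_(0 <= k <oo) (grid_weight m k.+1)%:E * em m k.+1 y)%E); last first.
  by rewrite leeDr.
apply: lee_nneseries => [k _ _|k _].
  by apply: mule_ge0; [rewrite lee_fin grid_weight_ge0|exact: integral_ge0].
rewrite lee_wpmul2l ?lee_fin ?grid_weight_ge0//=.
apply: ge0_le_integral => //.
- exact: (measurableT_comp (measurable_em m k) (measurable_shift m y)).
- exact: (measurable_expected_max_shift FF LL cQ ndQ Q0).
- by move=> w _; apply: (le_expected_max FF LL cQ ndQ Q0) => //; rewrite le_max lexx.
Qed.

(** Below [b] neither loss occurs: the forgotten point does not exceed the floor [b], and the term
    of index 0 is a multiple of [Q b = 0]. *)
Lemma grid_value_step_eq m y : y <= b ->
  ((expR (- (r * gtime m 1)))%:E * \int[P]_w grid_value m (y + L (gtime m 1) w)%R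
   = grid_value m y)%E.
Proof.
move=> yb; rewrite discounted_grid_value [RHS]nneseriesS; last by move=> k; exact: term_ge0.
rewrite [em m 0 y]/= max_l// Q0// mule0 add0e.
by apply: eq_eseriesr => k _ /=; rewrite max_l.
Qed.

(* The exponential time rounded up to the grid. Running the grid maximum until one step
   before it gives a lower bound of the supremum; running it until the rounded time
   gives in the limit an upper bound, at the cost of a factor exp(r h). *)
Definition grid_clock m (w : Omega) : nat := gceil m (Order.max 0 (e w)).

Let clock0 m : [set w | grid_clock m w = 0%N] = e @^-1` `]-oo, 0].
Proof.
apply/seteqP; split => w /=; rewrite in_itv/= /grid_clock.
  move=> E; have : (gceil m (Order.max 0%R (e w)) <= 0)%N by rewrite E.
  by rewrite gceil_le ?le_max ?lexx// gtime0 ge_max lexx.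
move=> e0; apply/eqP; rewrite -leqn0.
by rewrite gceil_le ?le_max ?lexx// gtime0 ge_max lexx.
Qed.

Let clockS m k : [set w | grid_clock m w = k.+1] = e @^-1` `]gtime m k, gtime m k.+1].
Proof.
have M0 w : 0 <= Order.max 0 (e w) by rewrite le_max lexx.
apply/seteqP; split => w /=; rewrite in_itv/= /grid_clock.
  move=> E; apply/andP; split.
    have : (k < gceil m (Order.max 0%R (e w)))%N by rewrite E.
    by rewrite gtime_lt_gceil// lt_max ltNge gtime_ge0.
  have : (gceil m (Order.max 0%R (e w)) <= k.+1)%N by rewrite E.
  by rewrite gceil_le// ge_max gtime_ge0.
move=> /andP[ke ek]; apply/eqP; rewrite eqn_leq gceil_le// ge_max gtime_ge0 ek/=.
by rewrite gtime_lt_gceil// lt_max ke orbT.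
Qed.

Let me : measurable_fun setT e. Proof. by case: he. Qed.

Lemma measurable_grid_clock m k : measurable [set w | grid_clock m w = k].
Proof.
by case: k => [|k]; [rewrite clock0|rewrite clockS]; rewrite -[X in measurable X]setTI; exact: me.
Qed.

Lemma prob_grid_clock0 m : P [set w | grid_clock m w = 0%N] = 0%E.
Proof.
rewrite (_ : [set _ | _] = ~` [set w | 0 < e w]).
  rewrite probability_setC; last first.
    rewrite (_ : [set _ | _] = e @^-1` `]0, +oo[).
      by rewrite -[X in measurable X]setTI; exact: me.
    by apply/seteqP; split => w /=; rewrite in_itv/= andbT.
  by case: he => _ ->//; rewrite mulr0 oppr0 expR0 subee.
rewrite clock0; apply/seteqP; split => w /=; rewrite in_itv/= leNgt => /negP//.
Qed.

Lemma prob_grid_clockS m k : P [set w | grid_clock m w = k.+1] = (grid_weight m k)%:E.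
Proof.
have mgt t : measurable [set w | t < e w].
  rewrite (_ : [set _ | _] = e @^-1` `]t, +oo[).
    by rewrite -[X in measurable X]setTI; exact: me.
  by apply/seteqP; split => w /=; rewrite in_itv/= andbT.
rewrite clockS (_ : _ @^-1` _ = [set w | gtime m k < e w] `\` [set w | gtime m k.+1 < e w]).
  case: he => _ pe.
  rewrite measureD; [|exact: mgt|exact: mgt|]; last by rewrite -ge0_fin_numE// fin_num_measure//; exact: mgt.
  rewrite (_ : _ `&` _ = [set w | gtime m k.+1 < e w]).
    by rewrite /grid_weight EFinB; congr (_ - _)%E; apply: pe; exact: gtime_ge0.
  apply/seteqP; split => w /= ; first by case.
  by move=> ke; split => //; apply: le_lt_trans ke; rewrite gtime_le.
apply/seteqP; split => w /=; rewrite in_itv/=.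
  by move=> /andP[-> /le_gtF ->].
by move=> [-> /negP]; rewrite -leNgt.
Qed.

Let mgm m y j : measurable_fun setT (gm m y j) := measurable_grid_max FF LL b m y j.

Let integral_gm m y j : (\int[P]_w (Q (gm m y j w))%:E = em m j y)%E.
Proof.
rewrite -(integral_expected_max FF LL cQ ndQ Q0 m y 0 j).
by apply: eq_integral => w _ /=; rewrite max_l// le_grid_max.
Qed.

Lemma integral_grid_clock m y k j :
  (\int[P]_(w in [set w | grid_clock m w = k]) (Q (gm m y j w))%:E =
   P [set w | grid_clock m w = k] * em m j y)%E.
Proof.
rewrite -integral_gm (@ge0_integral_event_indep _ _ _ P _ _ (EFin \o Q))//.
- exact: measurable_grid_clock.
- move=> c; have [B [mB ->]] : exists B, measurable B /\ [set w | grid_clock m w = k] = e @^-1` B.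
    by case: k => [|k]; [rewrite clock0; exists `]-oo, 0]%classic
      |rewrite clockS; exists `]gtime m k, gtime m k.+1]%classic].
  (* The grid maximum is at least [b], so for [c <= b] the event is empty; otherwise every grid time
     carries the same half-line condition. *)
  have [bc|cb] := ltP b c; last first.
    rewrite (_ : [set _ | _] = set0) ?set0I ?measure0 ?mul0e//.
    by apply/seteqP; split => w //=; rewrite grid_max_lt ltNge cb.
  have := hi (ts := fun i : 'I_j.+1 => gtime m i) (Bs := fun=> `]-oo, c - y[%classic) _ _ mB.
  rewrite (_ : \bigcap_i _ = [set w | gm m y j w < c]); first by apply => i //; exact: gtime_ge0.
  apply/seteqP; split => w /=; rewrite grid_max_lt bc/=.
    by move=> H; apply/forallP => i; have := H i Logic.I; rewrite /= in_itv/= ltrBrDl.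
  by move=> /forallP H i _; rewrite /= in_itv/= ltrBrDl.
- by apply/measurable_EFinP; exact: measurable_payoff.
- by move=> x; rewrite lee_fin (payoff_ge0 ndQ Q0).
Qed.

Let mQgm m y j : measurable_fun setT (fun w => (Q (gm m y j w))%:E).
Proof. by apply/measurable_EFinP; apply: (measurableT_comp (measurable_payoff cQ)). Qed.

(** The clock value [k.+1] has weight [k] and its predecessor is the last grid index strictly before
    [e], which matches the series term by term. The clock value 0, where [.-1] returns a default,
    has probability 0. *)
Lemma integral_grid_max_pred m y :
  (\int[P]_w (Q (gm m y (grid_clock m w).-1 w))%:E = grid_value m y)%E.
Proof.
rewrite (@ge0_integral_select _ _ _ P (fun k w => (Q (gm m y k.-1 w))%:E) (grid_clock m)).
- rewrite nneseriesS; last first.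
    by move=> k; apply: integral_ge0 => w _; rewrite lee_fin (payoff_ge0 ndQ Q0).
  rewrite integral_grid_clock prob_grid_clock0 mul0e add0e.
  by apply: eq_eseriesr => k _; rewrite integral_grid_clock prob_grid_clockS.
- by [].
- by move=> k w; rewrite lee_fin (payoff_ge0 ndQ Q0).
- exact: measurable_grid_clock.
Qed.

(** Here weight [k] meets the maximum over [k.+1] steps. The factor [expR (- (r * gtime m 1))]
    raises the index of the weight by one, leaving the series of [grid_value] without its first
    term. *)
Lemma integral_grid_max_clock m y :
  ((expR (- (r * gtime m 1)))%:E * \int[P]_w (Q (gm m y (grid_clock m w) w))%:E
   <= grid_value m y)%E.
Proof.
rewrite (@ge0_integral_select _ _ _ P (fun k w => (Q (gm m y k w))%:E) (grid_clock m)).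
- rewrite nneseriesS; last first.
    by move=> k; apply: integral_ge0 => w _; rewrite lee_fin (payoff_ge0 ndQ Q0).
  rewrite integral_grid_clock prob_grid_clock0 mul0e add0e.
  rewrite -nneseriesZl; last first.
    by move=> k _; apply: integral_ge0 => w _; rewrite lee_fin (payoff_ge0 ndQ Q0).
  rewrite [leRHS]nneseriesS; last by move=> k; exact: term_ge0.
  apply: (@le_trans _ _ (\sum_(0 <= k <oo) (grid_weight m k.+1)%:E * em m k.+1 y)%E); last first.
    by rewrite leeDr.
  apply: lee_nneseries => [k _ _|k _].
    apply: mule_ge0; first by rewrite lee_fin expR_ge0.
    by apply: integral_ge0 => w _; rewrite lee_fin (payoff_ge0 ndQ Q0).
  by rewrite integral_grid_clock prob_grid_clockS muleA -EFinM -grid_weightS.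
- by [].
- by move=> k w; rewrite lee_fin (payoff_ge0 ndQ Q0).
- exact: measurable_grid_clock.
Qed.

End discounted_value.

(** * The value of the supremum at an exponential time *)

Section value_function.
Context {d : measure_display} {Omega : measurableType d} {R : realType}.
Variables (P : probability Omega R) (F : R -> set (set Omega)) (L : R -> Omega -> R).
Hypotheses (FF : filtration F) (LL : levy_process P F L).
Variables (Q : R -> R) (b : R).
Hypotheses (cQ : continuous Q) (ndQ : {homo Q : x y / x <= y})
  (Q0 : forall x, x <= b -> Q x = 0).
Variables (r : R) (e : Omega -> R).
Hypotheses (r0 : 0 < r) (he : exponential_rv P r e) (hi : indep_of_process P e L).
Hypothesis intQ : forall y, P.-integrable setT (fun w => (Q (Sup_e L e y w))%:E).
Implicit Types (y : R) (m k : nat).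

Local Notation gm := (grid_max L b).
Local Notation gval := (grid_value P L Q b r).

Lemma le_Sup_e y w t : 0 <= t <= e w -> y + L t w <= Sup_e L e y w.
Proof.
move=> te; apply: ub_le_sup; last by exists t.
case: LL => _ [_ [rL [lL _]]].
have [M HM] := cadlag_bounded (e w) (rL w) (lL w).
by exists (y + M) => _ [s /HM Ls <-]; rewrite lerD2l.
Qed.

Lemma Sup_e_le y w c : 0 <= e w -> (forall t, 0 <= t <= e w -> y + L t w <= c) ->
  Sup_e L e y w <= c.
Proof.
move=> e0 H; apply: ge_sup; first by exists (y + L 0 w), 0; rewrite //= lexx.
by move=> _ [t /H te <-].
Qed.

Lemma Sup_e_shift y w : 0 <= e w -> Sup_e L e y w = y + Sup_e L e 0 w.
Proof.
move=> e0; apply/eqP; rewrite eq_le; apply/andP; split.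
  apply: Sup_e_le => // t te; rewrite lerD2l -[leLHS]add0r; exact: le_Sup_e.
rewrite -lerBrDl; apply: Sup_e_le => // t te.
by rewrite add0r lerBrDl; exact: le_Sup_e.
Qed.

(** On this null event the supremum of the empty set is the default 0 for every [y]. Monotonicity
    and continuity in [y] thus hold for every [w], not just almost every one. *)
Lemma Sup_e_neg y w : e w < 0 -> Sup_e L e y w = 0.
Proof.
move=> e0; rewrite /Sup_e (_ : [set _ | _ in _] = set0) ?sup0//.
apply/seteqP; split => // _ [t /= /andP[t0 te] _].
by move: (le_trans t0 te); rewrite leNgt e0.
Qed.

Lemma le_Sup_e_start y y' w : y <= y' -> Sup_e L e y w <= Sup_e L e y' w.
Proof.
move=> yy'; have [e0|e0] := leP 0 (e w); last by rewrite !Sup_e_neg.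
by rewrite (Sup_e_shift y e0) (Sup_e_shift y' e0) lerD2r.
Qed.

Lemma continuous_Sup_e_start w : continuous (fun y => Q (Sup_e L e y w)).
Proof.
move=> y; apply: (@continuous_comp _ _ _ (fun y => Sup_e L e y w) Q); last exact: cQ.
have [e0|e0] := leP 0 (e w).
  rewrite (_ : (fun _ => _) = (fun y => y + Sup_e L e 0 w)); last first.
    by apply/funext => y'; exact: Sup_e_shift.
  by apply: cvgD; [exact: cvg_id|exact: cvg_cst].
rewrite (_ : (fun _ => _) = (fun=> 0)); last by apply/funext => y'; exact: Sup_e_neg.
exact: cvg_cst.
Qed.

Let Q_ge0 x : 0 <= Q x := payoff_ge0 ndQ Q0 x.

Definition sup_value y : R := fine (\int[P]_w (Q (Sup_e L e y w))%:E).

Lemma sup_valueE y : (\int[P]_w (Q (Sup_e L e y w))%:E = (sup_value y)%:E)%E.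
Proof. by rewrite fineK//; apply: integrable_fin_num. Qed.

Lemma sup_value_ge0 y : 0 <= sup_value y.
Proof. by rewrite -lee_fin -sup_valueE; apply: integral_ge0 => w _; rewrite lee_fin. Qed.

Lemma le_sup_value y y' : y <= y' -> sup_value y <= sup_value y'.
Proof.
move=> yy'; rewrite -lee_fin -!sup_valueE; apply: le_integral => // w _.
by rewrite lee_fin; apply: ndQ; exact: le_Sup_e_start.
Qed.

Lemma continuous_sup_value : continuous sup_value.
Proof.
move=> y.
(* By monotonicity the integrand at [y + 1] dominates those on the whole interval around [y]. *)
have H := @continuity_under_integral R d Omega P (fun y w => Q (Sup_e L e y w)) setT
  measurableT (y - 1) (y + 1) (fun y _ => intQ y).
apply: (H _ (fun w => Q (Sup_e L e (y + 1) w)) (intQ _)).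
- by apply: nearW => w _ x _; exact: continuous_Sup_e_start.
- move=> x; rewrite /= in_itv/= => /andP[_ xy]; apply: nearW => w _.
  by rewrite ger0_norm//; apply/ndQ/le_Sup_e_start/ltW.
- by rewrite inE/= in_itv/= ltrDl ltrBlDr ltrDl ltr01.
Qed.

Let ae_pos : {ae P, forall w, 0 < e w}.
Proof.
have [me pe] := he; exists (~` [set w | 0 < e w]).
have mpos : measurable [set w | 0 < e w].
  rewrite (_ : [set _ | _] = e @^-1` `]0, +oo[).
    by rewrite -[X in measurable X]setTI; exact: me.
  by apply/seteqP; split => w /=; rewrite in_itv/= andbT.
split; [exact: measurableC| |by []].
rewrite probability_setC// (_ : P _ = 1%E) ?subee//.
by rewrite -[RHS](_ : (expR (- (r * 0)))%:E = _); [exact: pe|rewrite mulr0 oppr0 expR0].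
Qed.

Let measurable_Q_grid_max m y j : measurable_fun setT (fun w => (Q (gm m y j w))%:E).
Proof.
apply/measurable_EFinP; apply: (measurableT_comp (measurable_payoff cQ)).
exact: measurable_grid_max FF LL _ _ _ _.
Qed.

Lemma grid_value_le m y : (gval m y <= (sup_value y)%:E)%E.
Proof.
rewrite -sup_valueE -(integral_grid_max_pred FF LL cQ ndQ Q0 he hi).
apply: ae_ge0_le_integral => //.
- by move=> w _; rewrite lee_fin.
- apply: (measurable_fun_select (g := fun k w => (Q (gm m y k.-1 w))%:E)) => // k.
  exact: measurable_grid_clock he _ _.
- by move=> w _; rewrite lee_fin.
- exact: measurable_int (intQ y).
(* The grid maximum starts from [b], which may exceed the true supremum; [payoff_max] inserts [b] on
   the other side without changing [Q]. *)
apply: filterS ae_pos => w e0 _; rewrite lee_fin -[leRHS](payoff_max Q0 (b := b)).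
apply: ndQ.
have : forall j, (j <= (grid_clock e m w).-1)%N -> y + L (gtime m j) w <= Sup_e L e y w.
  move=> j jN; apply: le_Sup_e; rewrite gtime_ge0/=.
  have [->|j0] := posnP j; first by rewrite gtime0 ltW.
  have jN' : (j < grid_clock e m w)%N.
    by case: (grid_clock e m w) jN => [|n] //=; rewrite leqn0 => /eqP jE; rewrite jE in j0.
  move: jN'; rewrite /grid_clock max_r ?(ltW e0)// gtime_lt_gceil ?(ltW e0)//.
  exact: ltW.
elim: (_.-1) => [|k IH] H.
  by have := H _ (leqnn 0); rewrite gtime0 /= ge_max !le_max lexx/= => ->; rewrite orbT.
rewrite /= ge_max; apply/andP; split; first by apply: IH => j jk; apply: H; exact: leqW.
by rewrite le_max; apply/orP; right; apply: H.
Qed.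

Let min_payoff x x' : Order.min (Q x) (Q x') = Q (Order.min x x').
Proof.
case: (leP x x') => xx'; first by rewrite min_l// ndQ.
by rewrite min_r// ndQ// ltW.
Qed.

(** The rounded clock may overshoot [e], so the grid maximum is capped by the supremum, which also
    provides domination. Convergence then needs only one time [t <= e w] nearly attaining the
    supremum: its rounding stays within the rounded clock. *)
Lemma cvg_min_grid_max y w : 0 <= e w ->
  Order.min (gm m y (grid_clock e m w) w) (Sup_e L e y w) @[m --> \oo] --> Sup_e L e y w.
Proof.
move=> e0; apply/cvgrPdist_lt => /= eps eps0.
have [t te lt] : exists2 t, 0 <= t <= e w & Sup_e L e y w - eps < y + L t w.
  apply: contrapT => nex.
  have : Sup_e L e y w <= Sup_e L e y w - eps.
    apply: Sup_e_le => // t te; rewrite leNgt; apply/negP => lt; apply: nex.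
    by exists t.
  by rewrite leNgt ltrBlDr ltrDl eps0.
have /andP[t0 et] := te.
have cL : y + L (gtime m (gceil m t)) w @[m --> \oo] --> y + L t w.
  apply: cvgD; first exact: cvg_cst.
  apply: (@right_continuous_seq R Omega L w t (fun m => gtime m (gceil m t))) => //.
  - by case: LL => _ [_ []].
  - by move=> n; exact: le_gtime_gceil.
  - exact: cvg_gtime_gceil.
near=> m.
have ltm : Sup_e L e y w - eps < y + L (gtime m (gceil m t)) w.
  by near: m; exact: (cvgr_gt _ cL).
have leG : y + L (gtime m (gceil m t)) w <= gm m y (grid_clock e m w) w.
  apply: le_grid_max; rewrite /grid_clock max_r// gceil_le//.
  by apply: le_trans et _; exact: le_gtime_gceil.
rewrite ger0_norm; last by rewrite subr_ge0 ge_min lexx orbT.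
rewrite ltrBlDr -ltrBlDl lt_min; apply/andP; split; lra.
Unshelve. all: by end_near.
Qed.

Lemma cvg_grid_value_lower y (eps : R) : 0 < eps ->
  \forall m \near \oo, ((sup_value y - eps)%:E <= gval m y)%E.
Proof.
move=> eps0.
pose f m w : \bar R := (Order.min (Q (gm m y (grid_clock e m w) w)) (Q (Sup_e L e y w)))%:E.
have mf m : measurable_fun setT (f m).
  apply/measurable_EFinP; apply: measurable_minr.
    apply/measurable_EFinP.
    apply: (measurable_fun_select (g := fun k w => (Q (gm m y k w))%:E)) => // k.
    exact: measurable_grid_clock he _ _.
  apply/measurable_EFinP; exact: measurable_int (intQ y).
have [_ _ cv] : [/\ P.-integrable setT (fun w => (Q (Sup_e L e y w))%:E),
    (fun m => \int[P]_w `|f m w - (Q (Sup_e L e y w))%:E|)%E @ \oo --> 0%E &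
    (fun m => \int[P]_w f m w)%E @ \oo --> (\int[P]_w (Q (Sup_e L e y w))%:E)%E].
  apply: (@dominated_convergence _ _ _ P setT measurableT f _ (fun w => (Q (Sup_e L e y w))%:E)) => //.
  - exact: measurable_int (intQ y).
  - apply: filterS ae_pos => w /ltW e0 _; rewrite /f.
    apply: cvg_EFin; first exact: nearW.
    rewrite (_ : fine \o _ = (fun m => Q (Order.min (gm m y (grid_clock e m w) w) (Sup_e L e y w))));
      last by apply/funext => m /=; exact: min_payoff.
    by apply: (@continuous_cvg _ R R _ _
      (fun m => Order.min (gm m y (grid_clock e m w) w) (Sup_e L e y w)) Q);
      [exact: cQ|exact: cvg_min_grid_max].
  - apply: nearW => w m _; rewrite /f gee0_abs; last by rewrite lee_fin le_min !Q_ge0.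
    by rewrite lee_fin ge_min lexx orbT.
have cexp : expR (- (r * gtime m 1)) @[m --> \oo] --> (1 : R).
  rewrite -(_ : expR (- (r * 0)) = 1); last by rewrite mulr0 oppr0 expR0.
  apply: (@continuous_cvg _ R R _ _ (fun m => - (r * gtime m 1)) expR); first exact: continuous_expR.
  apply: cvgN; apply: cvgMr; rewrite /gtime.
  by under eq_fun do rewrite mul1r; exact: cvg_harmonic.
rewrite sup_valueE in cv.
have ca : expR (- (r * gtime m 1)) * fine (\int[P]_w f m w) @[m --> \oo] --> sup_value y.
  by rewrite -[X in _ --> X]mul1r; apply: cvgM => //; exact: fine_cvg cv.
have ifin m : (\int[P]_w f m w)%E \is a fin_num.
  apply: integrable_fin_num => //; apply: (le_integrable _ (mf m) _ (intQ y)) => // w _.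
  rewrite gee0_abs; last by rewrite lee_fin le_min !Q_ge0.
  by rewrite gee0_abs ?lee_fin// ge_min lexx orbT.
have : \forall m \near \oo, sup_value y - eps < expR (- (r * gtime m 1)) * fine (\int[P]_w f m w).
  by apply: (cvgr_gt _ ca); rewrite ltrBlDr ltrDl.
apply: filterS => m lt.
apply: le_trans (integral_grid_max_clock FF LL cQ ndQ Q0 r0 he hi m y).
apply: (@le_trans _ _ ((expR (- (r * gtime m 1)))%:E * \int[P]_w f m w)%E).
  by rewrite -(fineK (ifin m)) -EFinM lee_fin ltW.
rewrite lee_wpmul2l ?lee_fin ?expR_ge0//.
apply: ge0_le_integral => //.
- by move=> w _; rewrite lee_fin le_min !Q_ge0.
- apply: (measurable_fun_select (g := fun k w => (Q (gm m y k w))%:E)) => // k.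
  exact: measurable_grid_clock he _ _.
- by move=> w _; rewrite lee_fin ge_min lexx.
Qed.

Lemma grid_value_fin_num m y : gval m y \is a fin_num.
Proof.
rewrite ge0_fin_numE; last exact: (grid_value_ge0 P L ndQ Q0 r0).
by apply: le_lt_trans (grid_value_le m y) _; rewrite ltry.
Qed.

(** From above, [grid_value_le] and continuity of the limit suffice. From below, monotonicity
    replaces the moving point by a fixed one slightly to its left, where the pointwise lower bound
    applies; no uniformity in [y] is required. *)
Lemma cvg_grid_value (y_ : nat -> R) y : y_ m @[m --> \oo] --> y ->
  fine (gval m (y_ m)) @[m --> \oo] --> sup_value y.
Proof.
move=> yy; apply/cvgrPdist_lt => /= eps eps0.
have e2 : 0 < eps / 2 by rewrite divr_gt0.
have /cvgrPdist_lt /(_ _ e2) [/= dl dl0 Hd] := @continuous_sup_value y.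
have Uy m : sup_value (y_ m) @[m --> \oo] --> sup_value y.
  by apply: (@continuous_cvg _ R R _ _ y_ sup_value); [exact: continuous_sup_value|exact: yy].
near=> m.
have up : sup_value (y_ m) < sup_value y + eps.
  by near: m; apply: (cvgr_lt _ (Uy 0%N)); rewrite ltrDl.
have ym : y - dl / 2 < y_ m.
  by near: m; apply: (cvgr_gt _ yy); rewrite ltrBlDr ltrDl divr_gt0.
have lo : ((sup_value (y - dl / 2) - eps / 2)%:E <= gval m (y - dl / 2))%E.
  by near: m; exact: cvg_grid_value_lower.
have lo' := le_trans lo (le_grid_value FF LL cQ ndQ Q0 r0 m (ltW ym)).
have {}Hd : `|sup_value y - sup_value (y - dl / 2)| < eps / 2.
  apply: Hd; rewrite /= opprB addrC subrK gtr0_norm ?divr_gt0//.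
  by rewrite ltr_pdivrMr// ltr_pMr// ltr1n.
have hi' := grid_value_le m (y_ m).
rewrite -(fineK (grid_value_fin_num m (y_ m))) !lee_fin in lo' hi'.
move: Hd; rewrite ltr_norml => /andP[_ Hd].
by rewrite ltr_norml; apply/andP; split; lra.
Unshelve. all: by end_near.
Qed.

End value_function.

(** * Optional stopping *)

Section optional_stopping.
Context {d : measure_display} {Omega : measurableType d} {R : realType}.
Variable P : probability Omega R.
Variables (Y : nat -> Omega -> \bar R) (B : nat -> set Omega).
Hypotheses (mY : forall k, measurable_fun setT (Y k))
  (Y0 : forall k w, (0 <= Y k w)%E) (mB : forall k, measurable (B k))
  (B0 : B 0%N = setT) (BS : forall k, B k.+1 `<=` B k).

Let split_alive N : (\int[P]_(w in B N) Y N w =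
  \int[P]_(w in B N `\` B N.+1) Y N w + \int[P]_(w in B N.+1) Y N w)%E.
Proof.
have E : B N = (B N `\` B N.+1) `|` B N.+1.
  apply/seteqP; split => w /=.
    by move=> BN; have [?|?] := pselect (B N.+1 w); [right|left].
  by case=> [[]//|]; exact: BS.
rewrite {1}E ge0_integral_setU//.
- exact: measurableD.
- exact: measurable_funS (mY N).
- by apply/disj_setPS => w [[]].
Qed.

(** [B k] is the event of not having stopped before step [k]. At each step the part on [B N] splits
    into what stops at [N] and what survives, and only the survivors move on to [Y N.+1]. *)
Lemma optional_stopping_le :
  (forall N, \int[P]_(w in B N.+1) Y N.+1 w <= \int[P]_(w in B N.+1) Y N w)%E ->
  (\sum_(0 <= k <oo) \int[P]_(w in B k `\` B k.+1) Y k w <= \int[P]_w Y 0%N w)%E.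
Proof.
move=> step; apply: lime_le.
  by apply: is_cvg_nneseries => k _ _; exact: integral_ge0.
apply: nearW => N.
suff H : (\sum_(0 <= k < N) \int[P]_(w in B k `\` B k.+1) Y k w +
    \int[P]_(w in B N) Y N w <= \int[P]_w Y 0%N w)%E.
  by apply: le_trans H; rewrite leeDl// integral_ge0.
elim: N => [|N IH]; first by rewrite big_geq// add0e B0.
apply: le_trans IH; rewrite big_nat_recr//= -addeA leeD2l// [leRHS]split_alive.
by rewrite leeD2l.
Qed.

(** Paths that never stop contribute nothing to the series, so equality requires the surviving part
    to become arbitrarily small. *)
Lemma optional_stopping_eq :
  (forall N, \int[P]_(w in B N.+1) Y N.+1 w = \int[P]_(w in B N.+1) Y N w)%E ->
  (forall eps : R, 0 < eps -> exists N, (\int[P]_(w in B N) Y N w <= eps%:E)%E) ->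
  (\sum_(0 <= k <oo) \int[P]_(w in B k `\` B k.+1) Y k w = \int[P]_w Y 0%N w)%E.
Proof.
move=> step tail; apply/eqP; rewrite eq_le; apply/andP; split.
  by apply: optional_stopping_le => N; rewrite step.
apply/lee_addgt0Pr => eps eps0; have [N tN] := tail _ eps0.
have -> : (\int[P]_w Y 0%N w = \sum_(0 <= k < N) \int[P]_(w in B k `\` B k.+1) Y k w +
    \int[P]_(w in B N) Y N w)%E.
  elim: N {tN} => [|N ->]; first by rewrite big_geq// add0e B0.
  by rewrite big_nat_recr//= -addeA step -split_alive.
by apply: leeD => //; apply: nneseries_lim_ge => *; exact: integral_ge0.
Qed.

End optional_stopping.

(** * Stopping the grid value, and the limit of vanishing mesh *)

Section stopped_value.
Context {d : measure_display} {Omega : measurableType d} {R : realType}.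
Variables (P : probability Omega R) (F : R -> set (set Omega)) (L : R -> Omega -> R).
Hypotheses (FF : filtration F) (LL : levy_process P F L).

Lemma levy_markov_on (B : set Omega) (X : Omega -> R) s h (g : R -> \bar R) :
  0 <= s -> 0 <= h -> F s B -> (forall C, measurable C -> F s (X @^-1` C)) ->
  measurable_fun setT g -> (forall y, (0 <= g y)%E) ->
  (\int[P]_(w in B) g (X w + (L (s + h) w - L s w))%R =
   \int[P]_(w in B) \int[P]_w' g (X w + L h w')%R)%E.
Proof.
move=> s0 h0 FB FX mg g0.
pose T := g_sigma_algebraType (F s).
have mZ : measurable_fun [set: T] (fun w : T => (\1_B w : R, X w)).
  apply: measurable_fun_pair.
    apply: measurable_indic; exact: sub_sigma_algebra.
  by move=> _ C mC; rewrite setTI; apply: sub_sigma_algebra; exact: FX.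
have FZ C : measurable C -> F s ((fun w => (\1_B w : R, X w)) @^-1` C).
  move=> mC; have := mZ measurableT _ mC; rewrite setTI.
  by rewrite /measurable /= sigma_algebra_id//; case: FF => H _; exact: H.
(* The event travels as a real indicator in the state. The absolute value makes [f] nonnegative
   everywhere, as [levy_markov] demands, and does not affect an indicator. *)
pose f (z : (R * R) * R) := (g (z.1.2 + z.2)%R * `|z.1.1|%:E)%E.
have mf : measurable_fun setT f.
  apply: emeasurable_funM.
    apply: (measurableT_comp mg); apply: measurable_funD; last exact: measurable_snd.
    exact: (measurableT_comp measurable_snd measurable_fst).
  apply/measurable_EFinP; apply: (measurableT_comp (@normr_measurable _ setT)).
  exact: (measurableT_comp measurable_fst measurable_fst).
have f0 z : (0 <= f z)%E by rewrite mule_ge0// lee_fin.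
have iE w : `|\1_B w : R|%:E = (\1_B w)%:E :> \bar R by rewrite ger0_norm.
rewrite [LHS]integral_mkcond [RHS]integral_mkcond !epatch_indic.
transitivity (\int[P]_w f ((\1_B w, X w), (L (s + h) w - L s w)%R))%E.
  by apply: eq_integral => w _; rewrite /f/= iE.
rewrite (levy_markov FF LL s0 h0 FZ mf f0); apply: eq_integral => w _.
rewrite /f/= iE muleC -ge0_integralZl//.
- by apply: eq_integral => w' _; rewrite muleC.
- apply: (measurableT_comp mg); apply: measurable_funD => //.
  exact: measurable_levy FF LL _ h0.
Qed.

Variables (Q : R -> R) (b : R).
Hypotheses (cQ : continuous Q) (ndQ : {homo Q : x y / x <= y})
  (Q0 : forall x, x <= b -> Q x = 0).
Variables (r : R) (e : Omega -> R).
Hypotheses (r0 : 0 < r) (he : exponential_rv P r e) (hi : indep_of_process P e L).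
Hypothesis intQ : forall y, P.-integrable setT (fun w => (Q (Sup_e L e y w))%:E).

Local Notation gval := (grid_value P L Q b r).
Local Notation U := (sup_value P L Q e).

Let gval_ge0 m y : (0 <= gval m y)%E := grid_value_ge0 P L ndQ Q0 r0 m y.
Let mgval m : measurable_fun setT (gval m) := measurable_grid_value FF LL cQ ndQ Q0 r0 m.
Let gval_fin m y : gval m y \is a fin_num :=
  grid_value_fin_num FF LL cQ ndQ Q0 r0 he hi intQ m y.
Let gval_le m y : (gval m y <= (U y)%:E)%E := grid_value_le FF LL cQ ndQ Q0 he hi intQ m y.

Section grid_stopping.
Variables (x : R) (tau : Omega -> \bar R).
Hypothesis stau : stopping_time F tau.
Variable m : nat.

Let X k w := x + L (gtime m k) w.
Let Y k w : \bar R := ((expR (- (r * gtime m k)))%:E * gval m (X k w))%E.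
(** The event that the rounded time is at least the grid time [k]. The shift of index records that
    it is already known one grid step earlier. *)
Let B k : set Omega := if k is j.+1 then [set w | ((gtime m j)%:E < tau w)%E] else setT.

Let Y_ge0 k w : (0 <= Y k w)%E. Proof. by rewrite mule_ge0// lee_fin expR_ge0. Qed.

Let mX k : measurable_fun setT (X k).
Proof. by apply: measurable_funD => //; exact: measurable_levy FF LL _ (gtime_ge0 _ _). Qed.

Let mY k : measurable_fun setT (Y k).
Proof. by apply: emeasurable_funM => //; exact: (measurableT_comp (mgval m) (mX k)). Qed.

Let FB k : F (gtime m k) (B k.+1).
Proof. exact: (stopping_time_gt FF stau (gtime_ge0 _ _)). Qed.

Let mB k : measurable (B k).
Proof.
case: k => [|k]; first exact: measurableT.
exact: (filtration_measurable FF (gtime_ge0 m k) (FB k)).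
Qed.

Let BS k : B k.+1 `<=` B k.
Proof.
by case: k => [|k] w //=; apply: le_lt_trans; rewrite lee_fin gtime_le.
Qed.

Let measurable_next :
  measurable_fun setT (fun y : R => \int[P]_w gval m (y + L (gtime m 1) w)%R)%E.
Proof.
apply: (@measurable_fun_fubini_tonelli_F _ _ _ _ _ P
  (fun p : R * Omega => gval m (p.1 + L (gtime m 1) p.2))) => //.
apply: (measurableT_comp (mgval m)); apply: measurable_funD; first exact: measurable_fst.
exact: (measurableT_comp (measurable_levy FF LL (gtime_ge0 _ _)) measurable_snd).
Qed.

Let next_value N : (\int[P]_(w in B N.+1) Y N.+1 w =
  \int[P]_(w in B N.+1) ((expR (- (r * gtime m N)))%:E *
    ((expR (- (r * gtime m 1)))%:E * \int[P]_w' gval m (X N w + L (gtime m 1) w')%R)))%E.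
Proof.
pose g y : \bar R := ((expR (- (r * gtime m N.+1)))%:E * gval m y)%E.
transitivity (\int[P]_(w in B N.+1) g (X N w + (L (gtime m N + gtime m 1) w - L (gtime m N) w))%R)%E.
  by apply: eq_integral => w _; rewrite /Y /g /X -addrA subrKC -gtimeS.
rewrite levy_markov_on ?gtime_ge0//.
- apply: eq_integral => w _; rewrite /g ge0_integralZl//.
  + by rewrite muleA -EFinM -expRD -opprD -mulrDr -gtimeS.
  + apply: (measurableT_comp (mgval m)); apply: measurable_funD => //.
    exact: measurable_levy FF LL _ (gtime_ge0 _ _).
- move=> C mC; rewrite (_ : _ @^-1` _ = L (gtime m N) @^-1` ((fun z => x + z) @^-1` C))//.
  apply: (levy_adapted LL (gtime_ge0 _ _)).
  rewrite -[X in measurable X]setTI; apply: (_ : measurable_fun setT (fun z : R => x + z)) => //.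
  exact: measurable_funD.
- exact: emeasurable_funM.
- by move=> y; rewrite mule_ge0// lee_fin expR_ge0.
Qed.

Let step N : (\int[P]_(w in B N.+1) Y N.+1 w <= \int[P]_(w in B N.+1) Y N w)%E.
Proof.
rewrite next_value; apply: ge0_le_integral => //.
- by move=> w _; rewrite !mule_ge0 ?lee_fin ?expR_ge0// integral_ge0.
- apply: measurable_funS (measurableT) (@subsetT _ _) _.
  apply: emeasurable_funM => //; apply: emeasurable_funM => //.
  exact: (measurableT_comp measurable_next (mX N)).
- exact: measurable_funS (mY N).
- move=> w _; rewrite lee_wpmul2l ?lee_fin ?expR_ge0//.
  exact: (grid_value_step FF LL cQ ndQ Q0 r0).
Qed.

Let Z t w := expR (- (r * t)) * fine (gval m (x + L t w)).

Let sum_stopped : (\int[P]_w (eval_at Z (gup m (tau w)) w)%:E =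
  \sum_(0 <= k <oo) \int[P]_(w in B k `\` B k.+1) Y k w)%E.
Proof.
have t0 w : (0 <= tau w)%E by case: stau.
pose g k w := if k is j.+1 then Y j w else 0%E.
have g0 k w : (0 <= g k w)%E by case: k => [|k]; [exact: lexx|exact: Y_ge0].
rewrite (_ : (fun _ => _) = (fun w => g (gindex m (tau w)) w)); last first.
  apply/funext => w; case: (tau w) => //= t.
  by rewrite /Z /Y EFinM fineK.
rewrite ge0_integral_select.
- rewrite nneseriesS; last by move=> k; apply: integral_ge0 => w _; exact: g0.
  rewrite /= integral0 add0e; apply: eq_eseriesr => k _; congr (integral _ _ _).
  apply/seteqP; split => w /=; have := t0 w; case tE: (tau w) => [t| |]//= tge0.
  + move=> [E]; split.
      by case: k E => //= k E; rewrite tE lte_fin -gtime_lt_gceil// E.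
    by rewrite lte_fin -gtime_lt_gceil// E ltnn.
  + move=> [Bk]; rewrite lte_fin -gtime_lt_gceil// => /negP; rewrite -leqNgt => tk.
    congr S; apply/eqP; rewrite eqn_leq tk/=.
    by case: k Bk {tk} => //= k; rewrite tE lte_fin -gtime_lt_gceil.
  + by move=> [_]; rewrite ltry.
- by case=> [|k]; [exact: measurable_cst|exact: mY].
- exact: g0.
- by move=> k; apply: measurable_gindex => //; exact: (measurable_stopping_time FF).
Qed.

Let integral_Y0 : (\int[P]_w Y 0%N w = gval m x)%E.
Proof.
rewrite -[RHS]mule1 -(probability_setT P) -integral_cst//.
by apply: eq_integral => w _; rewrite /Y /X gtime0 mulr0 oppr0 expR0 mul1e (levy0 LL) addr0.
Qed.

Lemma stopped_grid_value_le :
  (\int[P]_w (eval_at Z (gup m (tau w)) w)%:E <= gval m x)%E.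
Proof.
rewrite sum_stopped -integral_Y0; exact: (optional_stopping_le mY Y_ge0 mB).
Qed.

Lemma stopped_grid_value_eq :
  (forall w t, 0 <= t -> (t%:E < tau w)%E -> x + L t w <= b) ->
  (\int[P]_w (eval_at Z (gup m (tau w)) w)%:E = gval m x)%E.
Proof.
move=> below; rewrite sum_stopped -integral_Y0.
have XB k w : B k.+1 w -> X k w <= b by apply: below; exact: gtime_ge0.
have stepE N : (\int[P]_(w in B N.+1) Y N.+1 w = \int[P]_(w in B N.+1) Y N w)%E.
  rewrite next_value; apply: eq_integral => w; rewrite inE => Bw.
  rewrite /Y (grid_value_step_eq FF LL cQ ndQ Q0 r0)//; exact: XB.
apply: (optional_stopping_eq mY Y_ge0 mB) => // eps eps0.
have Ub0 : 0 <= U b by exact: (sup_value_ge0 ndQ Q0 intQ).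
(* Chosen so that [r * gtime m k] exceeds [U b / eps]; then [1 + x <= expR x] gives
   [expR (- (r * gtime m k)) * U b <= eps]. *)
pose k := (Num.truncn (U b / eps * m.+1%:R / r)).+1.
(* Going back one step matters: on [B k.+1] the position at step [k] is at most [b], whereas the
   next one may have jumped above it. *)
exists k.+1; rewrite stepE.
apply: (@le_trans _ _ (\int[P]_(w in B k.+1) (cst (expR (- (r * gtime m k)) * U b)%:E) w)%E).
  apply: ge0_le_integral => //.
  - exact: measurable_funS (mY k).
  - move=> w Bw; rewrite /Y /= EFinM lee_wpmul2l ?lee_fin ?expR_ge0//.
    apply: le_trans (gval_le _ _).
    by apply: (le_grid_value FF LL cQ ndQ Q0 r0); exact: XB.
rewrite integral_cst//.
apply: (@le_trans _ _ ((expR (- (r * gtime m k)) * U b)%:E * 1)%E).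
  by rewrite lee_wpmul2l ?lee_fin ?mulr_ge0 ?expR_ge0// probability_le1.
rewrite mule1 lee_fin expRN ler_pdivrMl ?expR_gt0//.
rewrite -ler_pdivrMr//; apply: (@le_trans _ _ (r * gtime m k)); last first.
  by apply: le_trans (expR_ge1Dx _); rewrite lerDr.
rewrite /gtime mulrA ler_pdivlMr// (mulrC r) ltW// -ltr_pdivrMr//.
exact: truncnS_gt.
Qed.

End grid_stopping.

Lemma right_continuous_disc G x : continuous G ->
  right_continuous_paths (fun t w => expR (- (r * t)) * G (x + L t w)).
Proof.
move=> cG w t t0; apply: cvgM.
  apply: cvg_at_right_filter.
  apply: (@continuous_cvg _ R R _ _ (fun s => - (r * s)) expR); first exact: continuous_expR.
  by apply: cvgN; apply: cvgMr; exact: cvg_id.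
apply: (@continuous_cvg _ R R _ _ (fun s => x + L s w) G); first exact: cG.
by apply: cvgD; [exact: cvg_cst|case: LL => _ [_ [rL _]]; exact: rL].
Qed.

Lemma measurable_disc_payoff G x t : continuous G -> 0 <= t ->
  measurable_fun setT (fun w => expR (- (r * t)) * G (x + L t w)).
Proof.
move=> cG t0; apply: measurable_funM => //.
apply: (measurableT_comp (continuous_measurable_fun cG)); apply: measurable_funD => //.
exact: measurable_levy FF LL _ t0.
Qed.

Lemma measurable_disc G x tau : continuous G -> stopping_time F tau ->
  measurable_fun setT (fun w => disc r G L x (tau w) w).
Proof.
move=> cG st; apply: measurable_eval_at.
- exact: right_continuous_disc.
- by move=> t t0; exact: measurable_disc_payoff.
- exact: (measurable_stopping_time FF).
- by case: st.
Qed.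

Section stopping.
Variables (x : R) (tau : Omega -> \bar R) (K : Omega -> \bar R).
Hypotheses (stau : stopping_time F tau) (intK : P.-integrable setT K)
  (leK : forall t w, 0 <= t -> ((expR (- (r * t)) * U (x + L t w))%:E <= K w)%E).

Let Z m t w := expR (- (r * t)) * fine (gval m (x + L t w)).

Let U_ge0 y : 0 <= U y := sup_value_ge0 ndQ Q0 intQ y.

Let K_ge0 w : (0 <= K w)%E.
Proof. by apply: le_trans (leK w (lexx 0)); rewrite lee_fin mulr_ge0// expR_ge0. Qed.

(** The grid inside the value and the rounding of the time vary together, hence the use of
    [cvg_grid_value] along moving points. Since [gval] is at most [U], the bound [leK] at the
    rounded time dominates every mesh at once. *)
Let cvg_stopped : (\int[P]_w (eval_at (Z m) (gup m (tau w)) w)%:E)%E @[m --> \oo] -->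
  (\int[P]_w (disc r U L x (tau w) w)%:E)%E.
Proof.
have t0 w : (0 <= tau w)%E by case: stau.
pose f m w : \bar R := (eval_at (Z m) (gup m (tau w)) w)%:E.
have [] // := @dominated_convergence _ _ _ P setT measurableT f
  (fun w => (disc r U L x (tau w) w)%:E) K.
- move=> m; apply/measurable_EFinP; apply: measurable_eval_at_gup => //.
    move=> t t_ge0; apply: measurable_funM => //.
    apply: (@measurableT_comp _ _ _ _ _ _ fine) => //.
    apply: (measurableT_comp (mgval m)); apply: measurable_funD => //.
    exact: measurable_levy FF LL _ t_ge0.
  exact: (measurable_stopping_time FF).
- apply/measurable_EFinP; apply: measurable_disc => //.
  exact: (continuous_sup_value LL cQ ndQ Q0 intQ).
- apply: nearW => w _; apply: cvg_EFin; first exact: nearW.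
  rewrite /f /=; have := t0 w; case: (tau w) => [t| |]//= tge0; last exact: cvg_cst.
  have ct := cvg_gtime_gceil tge0.
  apply: cvgM.
    apply: (@continuous_cvg _ R R _ _ (fun m => - (r * gtime m (gceil m t))) expR).
      exact: continuous_expR.
    by apply: cvgN; apply: cvgMr.
  apply: (cvg_grid_value FF LL cQ ndQ Q0 r0 he hi intQ).
  apply: cvgD; first exact: cvg_cst.
  apply: (@right_continuous_seq R Omega L w t (fun m => gtime m (gceil m t))) => //.
  + by case: LL => _ [_ []].
  + by move=> n; exact: le_gtime_gceil.
- apply: nearW => w m _; rewrite /f; have := t0 w; case: (tau w) => [t| |]//= tge0; last 1 first.
  + by rewrite normr0.
  have g0 := gtime_ge0 m (gceil m t) : 0 <= (gtime m (gceil m t) : R).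
  apply: le_trans (leK w g0).
  rewrite ger0_norm; last by rewrite mulr_ge0 ?expR_ge0// fine_ge0.
  by rewrite lee_fin ler_wpM2l ?expR_ge0// -lee_fin fineK.
Qed.

Lemma integrable_disc_sup_value :
  P.-integrable setT (fun w => (disc r U L x (tau w) w)%:E).
Proof.
have mU : measurable_fun setT (fun w => (disc r U L x (tau w) w)%:E).
  apply/measurable_EFinP; apply: measurable_disc => //.
  exact: (continuous_sup_value LL cQ ndQ Q0 intQ).
apply: (le_integrable _ mU _ intK) => // w _.
rewrite [leRHS]gee0_abs//; have [/(_ w) + _] := stau.
case: (tau w) => [t| |]//= t0; last by rewrite normr0.
by rewrite ger0_norm ?leK// mulr_ge0// expR_ge0.
Qed.

Lemma stopped_sup_value_le : (\int[P]_w (disc r U L x (tau w) w)%:E <= (U x)%:E)%E.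
Proof.
apply: (cvge_to_le cvg_stopped); apply: nearW => m.
exact: le_trans (stopped_grid_value_le x stau m) (gval_le m x).
Qed.

Lemma stopped_sup_value_eq :
  (forall w t, 0 <= t -> (t%:E < tau w)%E -> x + L t w <= b) ->
  (\int[P]_w (disc r U L x (tau w) w)%:E = (U x)%:E)%E.
Proof.
move=> below; have := cvg_stopped.
under eq_fun do rewrite stopped_grid_value_eq//.
have cx : gval m x @[m --> \oo] --> (U x)%:E.
  apply: cvg_EFin; first exact: nearW.
  apply: (cvg_grid_value FF LL cQ ndQ Q0 r0 he hi intQ).
  exact: cvg_cst.
by move=> H; exact: (cvg_unique _ H cx).
Qed.

End stopping.
End stopped_value.

(** * The supremum of a process over all times *)

Section running_sup.
Context {d : measure_display} {Omega : measurableType d} {R : realType}.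
Variables (P : probability Omega R) (Z : R -> Omega -> R).
Hypotheses (rZ : right_continuous_paths Z)
  (mZ : forall t, 0 <= t -> measurable_fun setT (Z t)).

Definition running_sup w : \bar R :=
  ereal_sup [set (`|Z t w|)%:E | t in [set t : R | 0 <= t]].

Lemma le_running_sup t w : 0 <= t -> ((`|Z t w|)%:E <= running_sup w)%E.
Proof. by move=> t0; apply: ereal_sup_ubound; exists t. Qed.

Lemma running_sup_ge0 w : (0 <= running_sup w)%E.
Proof. by apply: le_trans (le_running_sup w (lexx 0)); rewrite lee_fin. Qed.

(** Exceeding a level is an open condition, so by right-continuity it is witnessed at a grid time.
    Measurability is what upgrades a finite integral of the supremum to integrability. *)
Lemma measurable_running_sup : measurable_fun setT running_sup.
Proof.
apply: (measurability (@ErealGenOInfty.G R)); first exact: ErealGenOInfty.measurableE.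
move=> _ [_ [c ->] <-]; rewrite setTI.
rewrite (_ : _ @^-1` _ = \bigcup_m \bigcup_k [set w | (c%:E < (`|Z (gtime m k) w|)%:E)%E]).
  apply: bigcup_measurable => m _; apply: bigcup_measurable => k _.
  rewrite -[X in measurable X]setTI; apply: emeasurable_fun_o_infty => //.
  apply/measurable_EFinP; apply: measurableT_comp; first exact: normr_measurable.
  exact/mZ/gtime_ge0.
apply/seteqP; split => w /=; rewrite in_itv/= andbT.
  move=> /ereal_sup_gt[_ [t t0 <-]]; rewrite lte_fin => ct.
  have cZ : `|Z (gtime m (gceil m t)) w| @[m --> \oo] --> `|Z t w|.
    apply: cvg_norm; apply: (@right_continuous_seq R Omega Z w t (fun m => gtime m (gceil m t))) => //.
    - by move=> n; exact: le_gtime_gceil.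
    - exact: cvg_gtime_gceil.
  near \oo => m; exists m => //; exists (gceil m t) => //=.
  by rewrite lte_fin; near: m; exact: (cvgr_gt _ cZ).
move=> [m _ [k _]] /= H; apply: lt_le_trans H _.
by apply: le_running_sup; exact: gtime_ge0.
Unshelve. all: by end_near.
Qed.

Lemma integrable_running_sup : (\int[P]_w running_sup w < +oo)%E ->
  P.-integrable setT running_sup.
Proof.
move=> H; apply/integrableP; split; first exact: measurable_running_sup.
by under eq_integral do rewrite gee0_abs ?running_sup_ge0//.
Qed.

End running_sup.

(** * The saddle point *)

Section opposite_process.
Context {d : measure_display} {Omega : measurableType d} {R : realType}.
Variables (P : probability Omega R) (F : R -> set (set Omega)) (L : R -> Omega -> R).

Let opp_preimage (B : set R) : measurable B -> measurable ((fun z => - z) @^-1` B).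
Proof.
move=> mB; rewrite -[X in measurable X]setTI.
have mN : measurable_fun setT (fun z : R => - z).
  by apply: continuous_measurable_fun; exact: opp_continuous.
exact: mN.
Qed.

Lemma levy_process_opp : levy_process P F L -> levy_process P F (fun t w => - L t w).
Proof.
move=> [L0 [aL [rL [lL [ind sta]]]]]; split; first by move=> w; rewrite L0 oppr0.
have E s t (B : set R) : [set w | B (- L t w - - L s w)] =
    [set w | ((fun z => - z) @^-1` B) (L t w - L s w)].
  by apply/seteqP; split => w; rewrite /= opprB opprK addrC.
repeat split.
- by move=> t B t0 mB; exact: (aL _ _ t0 (opp_preimage mB)).
- by move=> w t t0; apply: cvgN; exact: rL.
- by move=> w t t0; have [l lP] := lL w t t0; exists (- l); exact: cvgN.
- by move=> s t A B st FA mB; rewrite E; apply: ind => //; exact: opp_preimage.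
- move=> s t B st mB; rewrite E sta//; exact: opp_preimage.
Qed.

Lemma indep_of_process_opp (e : Omega -> R) :
  indep_of_process P e L -> indep_of_process P e (fun t w => - L t w).
Proof.
move=> hi n ts Bs C ts0 mBs mC.
exact: (hi n ts (fun i => (fun z => - z) @^-1` Bs i) C ts0 (fun i => opp_preimage (mBs i)) mC).
Qed.

(** As [inf] is defined from [sup] by reflection, the identity holds on every path, default values
    included. *)
Lemma Sup_e_opp (e : Omega -> R) x w :
  Sup_e (fun t w => - L t w) e (- x) w = - Inf_e L e x w.
Proof.
rewrite /Sup_e /Inf_e /inf opprK; congr sup; apply/seteqP; split => z /=.
  by move=> [t te <-]; exists (x + L t w); [exists t|rewrite opprD].
by move=> [_ [t te <-] <-]; exists t => //; rewrite opprD.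
Qed.

Lemma hit_above_entry_time x a :
  hit_above L x a = entry_time (fun t w => - x + - L t w) (- a).
Proof.
apply/funext => w; congr ereal_inf; apply/seteqP; split => _ [t [t0 ta] <-];
  exists t => //; split => //; by rewrite -opprD lerN2 in ta *.
Qed.

End opposite_process.

Section dynkin_game.
Context {d : measure_display} {Omega : measurableType d} {R : realType}.
Variables (P : probability Omega R) (F : R -> set (set Omega)) (L : R -> Omega -> R).
Hypotheses (UF : usual_conditions P F) (LL : levy_process P F L).
Let FF : filtration F := proj1 UF.
Variables (r : R) (G1 G2 : R -> R) (e : Omega -> R) (xI xS : R) (QI QS : R -> R).
Hypotheses (r0 : 0 < r) (cG1 : continuous G1) (cG2 : continuous G2)
  (G12 : forall x, G1 x <= G2 x).
Let runsup G (x : R) : Omega -> \bar R :=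
  running_sup (fun t w => expR (- (r * t)) * G (x + L t w)).
Hypotheses (iG1 : forall x, (\int[P]_w runsup G1 x w < +oo)%E)
  (iG2 : forall x, (\int[P]_w runsup G2 x w < +oo)%E).
Hypotheses (he : exponential_rv P r e) (hi : indep_of_process P e L)
  (intI : forall x, P.-integrable setT (fun w => (QI (Inf_e L e x w))%:E))
  (intS : forall x, P.-integrable setT (fun w => (QS (Sup_e L e x w))%:E))
  (IS : xI < xS) (cQI : continuous QI) (cQS : continuous QS)
  (ndI : {homo QI : a b / a <= b}) (ndS : {homo QS : a b / a <= b})
  (QI0 : forall x, xI <= x -> QI x = 0) (QS0 : forall x, x <= xS -> QS x = 0).

(* The infimum part is the supremum part of the reflected process. *)
Let L' t w := - L t w.
Let LL' : levy_process P F L' := levy_process_opp LL.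
Let hi' : indep_of_process P e L' := indep_of_process_opp hi.
Let QI' z := - QI (- z).

Let cQI' : continuous QI'.
Proof.
move=> z; apply: cvgN; apply: (@continuous_cvg _ R R _ _ (fun s => - s) QI); first exact: cQI.
by apply: cvgN; exact: cvg_id.
Qed.

Let ndI' : {homo QI' : a b / a <= b}.
Proof. by move=> a b' ab; rewrite lerN2; apply: ndI; rewrite lerN2. Qed.

Let QI'0 z : z <= - xI -> QI' z = 0.
Proof. by move=> zI; rewrite /QI' QI0 ?oppr0// lerNr. Qed.

Let intI' y : P.-integrable setT (fun w => (QI' (Sup_e L' e y w))%:E).
Proof.
rewrite -[y]opprK (_ : (fun _ => _) = (\- (fun w => (QI (Inf_e L e (- y) w))%:E))%E).
  exact/integrableN/intI.
by apply/funext => w; rewrite /QI' Sup_e_opp opprK.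
Qed.

Let U := sup_value P L QS e.
Let D y := sup_value P L' QI' e (- y).
Let v y := U y - D y.

Lemma game_valueE y : (\int[P]_w (QI (Inf_e L e y w))%:E +
  \int[P]_w (QS (Sup_e L e y w))%:E = (v y)%:E)%E.
Proof.
rewrite (sup_valueE intS) /v addeC EFinB; congr (_ + _)%E.
rewrite -(sup_valueE intI') -integral_ge0N//.
  by apply: eq_integral => w _; rewrite /QI' Sup_e_opp opprK -EFinN opprK.
by move=> w _; rewrite lee_fin (payoff_ge0 ndI' QI'0).
Qed.

Hypotheses (VG1 : forall x, xS <= x -> v x = G1 x) (VG2 : forall x, x <= xI -> v x = G2 x)
  (VG : forall x, xI <= x <= xS -> G1 x <= v x <= G2 x).

Lemma game_value_bounds y : G1 y <= v y <= G2 y.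
Proof.
have [yS|Sy] := leP y xS; last by rewrite VG1 ?lexx ?G12// ltW.
have [yI|Iy] := leP y xI; first by rewrite VG2 ?lexx ?G12.
by apply: VG; rewrite yS ltW.
Qed.

Let U_ge0 y : 0 <= U y := sup_value_ge0 ndS QS0 intS y.
Let D_ge0 y : 0 <= D y := sup_value_ge0 ndI' QI'0 intI' (- y).

Let C := U xS + D xI.

(* Only v = U - D is controlled by G1 and G2, but by monotonicity U is bounded on
   ]-oo, xS] and D on [xS, +oo[. *)
Let UD_le y : U y <= `|G1 y| + `|G2 y| + C /\ D y <= `|G1 y| + `|G2 y| + C.
Proof.
have /andP[vG1 vG2] := game_value_bounds y.
have a1 := ler_norm (G2 y); have a2 : - G1 y <= `|G1 y| by rewrite -normrN ler_norm.
have a3 := normr_ge0 (G1 y); have a4 := normr_ge0 (G2 y).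
have := U_ge0 xS; have := D_ge0 xI; have := U_ge0 y; have := D_ge0 y.
rewrite /v in vG1 vG2; rewrite /C => ? ? ? ?.
have [yS|Sy] := leP y xS.
  have : U y <= U xS by exact: (le_sup_value LL ndS intS).
  move=> ?; split; lra.
have : D y <= D xI by apply: (le_sup_value LL' ndI' intI'); rewrite lerN2 ltW// (lt_trans IS).
move=> ?; split; lra.
Qed.

(** One integrable majorant for both [U] and [D] along the discounted path: the discount factor is
    at most 1 and [C] is integrable under a probability. *)
Let K x w := (runsup G1 x w + runsup G2 x w + C%:E)%E.

Let intG x (G : R -> R) : continuous G -> (\int[P]_w runsup G x w < +oo)%E ->
  P.-integrable setT (runsup G x).
Proof.
move=> cG; apply: integrable_running_sup.
- exact: (right_continuous_disc LL).
- by move=> t t0; exact: (measurable_disc_payoff FF LL).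
Qed.

Let intK x : P.-integrable setT (K x).
Proof.
apply: integrableD => //; last exact: finite_measure_integrable_cst.
by apply: integrableD => //; exact: intG.
Qed.

Let disc_le_K (H : R -> R) x t w : (forall y, 0 <= H y <= `|G1 y| + `|G2 y| + C) -> 0 <= t ->
  ((expR (- (r * t)) * H (x + L t w))%:E <= K x w)%E.
Proof.
move=> HG t0; set y := x + L t w; have /andP[_ Hy] := HG y.
have E1 : expR (- (r * t)) <= 1 by rewrite -expR0 ler_expR oppr_le0 mulr_ge0// ltW.
have E0 := expR_ge0 (- (r * t)).
have C0 : 0 <= C by rewrite addr_ge0.
apply: (@le_trans _ _ (`|expR (- (r * t)) * G1 y|%:E + `|expR (- (r * t)) * G2 y|%:E + C%:E)%E).
  rewrite -!EFinD lee_fin !normrM (ger0_norm E0).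
  apply: (@le_trans _ _ (expR (- (r * t)) * (`|G1 y| + `|G2 y| + C))); first exact: ler_wpM2l.
  by rewrite mulrDr [X in X + _]mulrDr lerD2l ler_piMl.
by rewrite leeD2r// leeD//; [exact: (le_running_sup (fun t w => expR (- (r * t)) * G1 (x + L t w)))
  |exact: (le_running_sup (fun t w => expR (- (r * t)) * G2 (x + L t w)))].
Qed.

Let leKU x t w : 0 <= t -> ((expR (- (r * t)) * U (x + L t w))%:E <= K x w)%E.
Proof. by apply: disc_le_K => y; rewrite U_ge0; case: (UD_le y). Qed.

Let leKD x t w : 0 <= t ->
  ((expR (- (r * t)) * sup_value P L' QI' e (- x + L' t w))%:E <= K x w)%E.
Proof.
by rewrite -opprD; apply: (@disc_le_K D) => y; rewrite D_ge0; case: (UD_le y).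
Qed.

Let disc_v x u w : disc r v L x u w = disc r U L x u w -
  disc r (sup_value P L' QI' e) L' (- x) u w.
Proof. by case: u => [t| |]/=; rewrite ?subr0// -mulrBr -opprD. Qed.

Let intU x tau : stopping_time F tau ->
  P.-integrable setT (fun w => (disc r U L x (tau w) w)%:E).
Proof.
by move=> st; apply: (integrable_disc_sup_value FF LL cQS ndS QS0 intS st (intK x)) => t w; exact: leKU.
Qed.

Let intD x tau : stopping_time F tau ->
  P.-integrable setT (fun w => (disc r (sup_value P L' QI' e) L' (- x) (tau w) w)%:E).
Proof.
by move=> st; apply: (integrable_disc_sup_value FF LL' cQI' ndI' QI'0 intI' st (intK x)) => t w; exact: leKD.
Qed.

Let integral_disc_v x tau : stopping_time F tau ->
  (\int[P]_w (disc r v L x (tau w) w)%:E = \int[P]_w (disc r U L x (tau w) w)%:E -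
    \int[P]_w (disc r (sup_value P L' QI' e) L' (- x) (tau w) w)%:E)%E.
Proof.
move=> st; rewrite -integralB//; [|exact: intU|exact: intD].
by apply: eq_integral => w _; rewrite disc_v EFinB.
Qed.

Let int_disc_v x tau : stopping_time F tau ->
  P.-integrable setT (fun w => (disc r v L x (tau w) w)%:E).
Proof.
move=> st; rewrite (_ : (fun _ => _) = (fun w => (disc r U L x (tau w) w)%:E -
    (disc r (sup_value P L' QI' e) L' (- x) (tau w) w)%:E)%E).
  by apply: integrableB => //; [exact: intU|exact: intD].
by apply/funext => w; rewrite disc_v EFinB.
Qed.

Lemma integrable_payoff x sigma tau : stopping_time F sigma -> stopping_time F tau ->
  P.-integrable setT (fun w => (if (tau w <= sigma w)%E then disc r G1 L x (tau w) w
             else disc r G2 L x (sigma w) w)%:E).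
Proof.
move=> ss st; have [s0 _] := ss; have [t0 _] := st.
have mpay : measurable_fun setT (fun w => if (tau w <= sigma w)%E then disc r G1 L x (tau w) w
             else disc r G2 L x (sigma w) w).
  apply: measurable_fun_ifT.
  - apply: (measurable_fun_bool true).
    by apply: measurable_lee => //; exact: (measurable_stopping_time FF).
  - exact: (measurable_disc FF LL).
  - exact: (measurable_disc FF LL).
have leG G y u w : (0 <= u)%E -> ((`|disc r G L y u w|)%:E <= runsup G y w)%E.
  case: u => [t| |]//= u0; last by rewrite normr0 running_sup_ge0.
  by apply: (le_running_sup (fun t w => expR (- (r * t)) * G (y + L t w))).
apply: (@le_integrable _ _ _ P setT _ _ (fun w => runsup G1 x w + runsup G2 x w)%E) => //.
- exact/measurable_EFinP.
- move=> w _; rewrite [leRHS]gee0_abs; last by rewrite adde_ge0 ?running_sup_ge0.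
  case: ifPn => _; rewrite /=.
    by apply: le_trans (leG _ _ _ _ (t0 w)) _; rewrite leeDl// running_sup_ge0.
  by apply: le_trans (leG _ _ _ _ (s0 w)) _; rewrite leeDr// running_sup_ge0.
- by apply: integrableD => //; exact: intG.
Qed.

Let adapted_shift x (M : R -> Omega -> R) (LM : levy_process P F M) (t : R) (B : set R) :
  0 <= t -> measurable B -> F t ((fun w => x + M t w) @^-1` B).
Proof.
move=> t0 mB; rewrite (_ : _ @^-1` _ = M t @^-1` ((fun z => x + z) @^-1` B))//.
apply: (levy_adapted LM t0).
rewrite -[X in measurable X]setTI; apply: (_ : measurable_fun setT (fun z : R => x + z)) => //.
exact: measurable_funD.
Qed.

Let right_continuous_shift x (M : R -> Omega -> R) (LM : levy_process P F M) :
  right_continuous_paths (fun t w => x + M t w).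
Proof.
by move=> w t t0; apply: cvgD; [exact: cvg_cst|case: LM => _ [_ [rM _]]; exact: rM].
Qed.

Lemma stopping_time_hit_below x : stopping_time F (hit_below L x xI).
Proof.
apply: (stopping_time_entry_time UF (Y := fun t w => x + L t w)).
- exact: right_continuous_shift LL.
- by move=> t B t0 mB; apply: (adapted_shift _ LL).
Qed.

Lemma stopping_time_hit_above x : stopping_time F (hit_above L x xS).
Proof.
rewrite hit_above_entry_time; apply: (stopping_time_entry_time UF).
- exact: right_continuous_shift LL'.
- by move=> t B t0 mB; apply: (adapted_shift _ LL').
Qed.

Lemma Mx_hit_below_le x tau : stopping_time F tau ->
  (Mx P r G1 G2 L x (hit_below L x xI) tau <= (v x)%:E)%E.
Proof.
move=> st; have ss := stopping_time_hit_below x; set sigma := hit_below L x xI in ss *.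
pose rho w := Order.min (sigma w) (tau w).
have sr : stopping_time F rho by exact: (stopping_time_min FF).
(* Pathwise, stopping at [tau] pays [G1], at most [v]. Stopping strictly earlier at [sigma] pays
   [G2], equal to [v] there, since at a finite entry time the path really lies in the closed
   half-line. Infinite times give 0 on both sides. *)
apply: (@le_trans _ _ (\int[P]_w (disc r v L x (rho w) w)%:E)%E).
  apply: le_integral => //; [exact: integrable_payoff|exact: int_disc_v|].
  move=> w _; rewrite lee_fin /rho; have [ts|ts] := leP (tau w) (sigma w).
    case: (tau w) => [t| |] /=; [|exact: lexx|exact: lexx]; rewrite ler_wpM2l ?expR_ge0//.
    by case/andP: (game_value_bounds (x + L t w)).
  case E : (sigma w) => [t| |] /=; [|exact: lexx|exact: lexx]; rewrite VG2//.
  have E' : entry_time (fun t w => x + L t w) xI w = t%:E by exact: E.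
  by have := entry_time_attained (@right_continuous_shift x L LL) E'.
rewrite integral_disc_v// /v EFinB; apply: leeB.
  by apply: (stopped_sup_value_le FF LL cQS ndS QS0 r0 he hi intS sr (intK x)) => t w; exact: leKU.
rewrite (stopped_sup_value_eq FF LL' cQI' ndI' QI'0 r0 he hi' intI' sr (intK x))//.
  by move=> t w; exact: leKD.
move=> w t t0; rewrite lt_min => /andP[ts _].
by rewrite -opprD lerN2 ltW//; exact: (lt_entry_time (Y := fun t w => x + L t w) t0 ts).
Qed.

Lemma Mx_hit_above_ge x sigma : stopping_time F sigma ->
  ((v x)%:E <= Mx P r G1 G2 L x sigma (hit_above L x xS))%E.
Proof.
move=> ss; have st := stopping_time_hit_above x; set tau := hit_above L x xS in st *.
pose rho w := Order.min (sigma w) (tau w).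
have sr : stopping_time F rho by exact: (stopping_time_min FF).
(* The mirror comparison: at [tau] the payoff [G1] equals [v], ties included, and strictly before it
   the payoff [G2] is at least [v]. *)
apply: (@le_trans _ _ (\int[P]_w (disc r v L x (rho w) w)%:E)%E); last first.
  apply: le_integral => //; [exact: int_disc_v|exact: integrable_payoff|].
  move=> w _; rewrite lee_fin /rho; have [ts|ts] := leP (tau w) (sigma w).
    case E : (tau w) => [t| |] /=; [|exact: lexx|exact: lexx]; rewrite VG1//.
    have := E; rewrite /tau hit_above_entry_time => E'.
    have := entry_time_attained (@right_continuous_shift (- x) L' LL') E'.
    by rewrite -opprD lerN2.
  case: (sigma w) => [t| |] /=; [|exact: lexx|exact: lexx]; rewrite ler_wpM2l ?expR_ge0//.
  by case/andP: (game_value_bounds (x + L t w)).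
rewrite integral_disc_v// /v EFinB; apply: leeB; last first.
  by apply: (stopped_sup_value_le FF LL' cQI' ndI' QI'0 r0 he hi' intI' sr (intK x)) => t w; exact: leKD.
rewrite (stopped_sup_value_eq FF LL cQS ndS QS0 r0 he hi intS sr (intK x))//.
  by move=> t w; exact: leKU.
move=> w t t0; rewrite lt_min => /andP[_].
rewrite /tau hit_above_entry_time => ts; apply: ltW.
by have := lt_entry_time t0 ts; rewrite -opprD ltrN2.
Qed.

End dynkin_game.

Theorem theorem1 (d : measure_display) (Omega : measurableType d) (R : realType)
  (P : probability Omega R) (F : R -> set (set Omega)) (L : R -> Omega -> R)
  (r : R) (G1 G2 : R -> R) (e : Omega -> R)
  (xI xS : R) (QI QS : R -> R) :
  usual_conditions P F ->
  levy_process P F L ->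
  0 < r ->
  continuous G1 -> continuous G2 ->
  (forall x, G1 x <= G2 x) ->
  (forall x : R, (\int[P]_w ereal_sup [set (`|expR (- (r * t)) * G1 (x + L t w)|%R)%:E
                          | t in [set t : R | (0 <= t)%R]] < +oo)%E) ->
  (forall x : R, (\int[P]_w ereal_sup [set (`|expR (- (r * t)) * G2 (x + L t w)|%R)%:E
                          | t in [set t : R | (0 <= t)%R]] < +oo)%E) ->
  (forall x, {ae P, forall w, (expR (- (r * t)) * G1 (x + L t w)) @[t --> +oo] --> 0}) ->
  (forall x, {ae P, forall w, (expR (- (r * t)) * G2 (x + L t w)) @[t --> +oo] --> 0}) ->
  exponential_rv P r e ->
  indep_of_process P e L ->
  (forall x, P.-integrable setT (fun w => (QI (Inf_e L e x w))%:E)) ->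
  (forall x, P.-integrable setT (fun w => (QS (Sup_e L e x w))%:E)) ->
  xI < xS ->
  continuous QI -> continuous QS ->
  {homo QI : a b / a <= b} -> {homo QS : a b / a <= b} ->
  (forall x, xI <= x -> QI x = 0) ->
  (forall x, x <= xS -> QS x = 0) ->
  let V := fun x => (\int[P]_w (QI (Inf_e L e x w))%:E
                     + \int[P]_w (QS (Sup_e L e x w))%:E)%E in
  (forall x, xS <= x -> V x = (G1 x)%:E) ->
  (forall x, x <= xI -> V x = (G2 x)%:E) ->
  (forall x, xI <= x <= xS -> ((G1 x)%:E <= V x /\ V x <= (G2 x)%:E)%E) ->
  forall x,
    V x = ereal_inf [set ereal_sup [set Mx P r G1 G2 L x sigma tau
                                   | tau in stopping_time F]
                    | sigma in stopping_time F] /\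
    V x = ereal_sup [set ereal_inf [set Mx P r G1 G2 L x sigma tau
                                   | sigma in stopping_time F]
                    | tau in stopping_time F] /\
    V x = Mx P r G1 G2 L x (hit_below L x xI) (hit_above L x xS).
Proof.
move=> UF LL r0 cG1 cG2 G12 iG1 iG2 _ _ he hi intI intS IS cQI cQS ndI ndS QI0 QS0 V.
pose v y := sup_value P L QS e y -
  sup_value P (fun t w => - L t w) (fun z => - QI (- z)) e (- y).
have VE y : V y = (v y)%:E by rewrite /V (game_valueE intI intS ndI QI0).
move=> VG1 VG2 VG x.
have vG1 y : xS <= y -> v y = G1 y by move=> /VG1; rewrite VE => -[].
have vG2 y : y <= xI -> v y = G2 y by move=> /VG2; rewrite VE => -[].
have vG y : xI <= y <= xS -> G1 y <= v y <= G2 y.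
  by move=> /VG; rewrite VE !lee_fin => -[-> ->].
have ss := stopping_time_hit_below UF LL xI x.
have st := stopping_time_hit_above UF LL xS x.
have upper tau : stopping_time F tau ->
    (Mx P r G1 G2 L x (hit_below L x xI) tau <= V x)%E.
  by rewrite VE; exact: (Mx_hit_below_le UF LL r0 cG1 cG2 G12 iG1 iG2 he hi intI intS IS cQI cQS ndI ndS QI0 QS0 vG1 vG2 vG).
have lower sigma : stopping_time F sigma ->
    (V x <= Mx P r G1 G2 L x sigma (hit_above L x xS))%E.
  by rewrite VE; exact: (Mx_hit_above_ge UF LL r0 cG1 cG2 G12 iG1 iG2 he hi intI intS IS cQI cQS ndI ndS QI0 QS0 vG1 vG2 vG).
(* Each bound fixes one player at the hitting time of the saddle pair: [lower] holds against every
   [sigma], [upper] against every [tau], and at the pair itself they meet. *)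
split; [|split]; apply/eqP; rewrite eq_le; apply/andP; split.
- apply: le_ereal_inf_tmp => _ [sigma fs <-]; apply: le_trans (lower _ fs) _.
  by apply: ereal_sup_ubound; exists (hit_above L x xS).
- apply: (@le_trans _ _ (ereal_sup [set Mx P r G1 G2 L x (hit_below L x xI) tau
      | tau in stopping_time F])).
    by apply: ereal_inf_lbound; exists (hit_below L x xI).
  by apply: ge_ereal_sup => _ [tau ft <-]; exact: upper.
- apply: (@le_trans _ _ (ereal_inf [set Mx P r G1 G2 L x sigma (hit_above L x xS)
      | sigma in stopping_time F])).
    by apply: le_ereal_inf_tmp => _ [sigma fs <-]; exact: lower.
  by apply: ereal_sup_ubound; exists (hit_above L x xS).
- apply: ge_ereal_sup => _ [tau ft <-]; apply: le_trans (upper _ ft).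
  by apply: ereal_inf_lbound; exists (hit_below L x xI).
- exact: lower.
- exact: upper.
Qed.
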